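(* For $M\in\mathbb N$ let $u^M$ be the spectral Galerkin approximation, i.e. the solution of $du^M(t)=\bm{i}\Delta_Mu^M(t)\,dt+\bm{i}\alpha P_M\,dW(t)$, $t>0$, $u^M(0)=P_Mu_0$, described in the context, and put $B^M_T=\frac{u^M(T)}{T}$ for $T>0$. Then for each fixed $M\in\mathbb N$, $\{B^M_T\}_{T>0}$ satisfies a large deviations principle (as $T\to\infty$, with speed $T$) on $H^0=L^2(0,\pi;\mathbb C)$ with the good rate function $$I^M(x)=\begin{cases}\frac1{\alpha^2}\left\|Q_M^{-\frac12}x\right\|_{H^0}^2,&\text{if }x\in Q_M^{\frac12}(H^0),\\+\infty,&\text{otherwise,}\end{cases}$$ where $Q_M:=QP_M$ and $Q_M^{-\frac12}$ is the pseudo inverse of $Q_M^{\frac12}$ on $H_M$, i.e. $Q_M^{-\frac12}x=\operatorname{argmin}_z\{\|z\|_{H^0}: z\in H_M,\ Q_M^{\frac12}z=x\}$ for every $x\in Q_M^{\frac12}(H_M)$.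
   Context: Notation: $\bm{i}$ is the imaginary unit; $H^0=L^2(0,\pi;\mathbb C)$, $U^0=L^2(0,\pi;\mathbb R)$, $U^1=H^1(0,\pi;\mathbb R)$, $H^1_0(0,\pi)=\{f\in H^1(0,\pi;\mathbb C): f(0)=f(\pi)=0\}$; $\langle f,g\rangle_{\mathbb C}=\int_0^\pi f\bar g\,dx$. $H^0$ is regarded as a real Hilbert space with $\langle f,g\rangle_{\mathbb R}=\Re\langle f,g\rangle_{\mathbb C}$. Setting: $\alpha>0$; $\Delta$ is the Dirichlet Laplacian on $(0,\pi)$; $e_k(x)=\sqrt{2/\pi}\,\sin(kx)$, so $\Delta e_k=-k^2e_k$. $Q$ is a nonnegative symmetric operator on $U^0$ with $Qe_k=\eta_ke_k$ for a non-increasing sequence $\{\eta_k\}_{k\in\mathbb N}$ of nonnegative reals, and $Q^{1/2}$ is a Hilbert--Schmidt operator from $U^0$ to $U^1$. $Q$ is extended to $H^0$ by $Qf=Q(\Re f)+\bm{i}Q(\Im f)$. $W(t)=\sum_{k\ge1}\sqrt{\eta_k}\,\beta_k(t)e_k$ is a $U^0$-valued $Q$-Wiener process, with $\beta_k$ independent standard real Brownian motions on a complete filtered probability space satisfying the usual conditions. $u_0\in H^1_0(0,\pi)$ is deterministic. Galerkin approximation: $H_M=\mathrm{span}_{\mathbb C}\{e_1,\dots,e_M\}\subset H^0$, $P_Mx=\sum_{k=1}^M\langle x,e_k\rangle_{\mathbb C}e_k$, $\Delta_M=\Delta P_M$, $S_M(t)=e^{\bm{i}t\Delta_M}$, and $u^M(t)=S_M(t)P_Mu_0+\bm{i}\alpha\int_0^tS_M(t-s)P_M\,dW(s)\in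 H_M$. LDP: a function $I:\mathcal X\to[0,\infty]$ on a Hausdorff topological space is a rate function if it is lower semicontinuous, and a good rate function if all level sets $\{I\le a\}$, $a\in[0,\infty)$, are compact. A family $\{Z_T\}_{T>0}$ of $\mathcal X$-valued random variables satisfies an LDP with rate function $I$ if $\liminf_{T\to\infty}\frac1T\ln \mathbf P(Z_T\in G)\ge-\inf_G I$ for every open $G$ and $\limsup_{T\to\infty}\frac1T\ln \mathbf P(Z_T\in C)\le-\inf_C I$ for every closed $C$. *)

(* Defs.v *)
From HB Require Import structures.
From mathcomp Require Import all_boot all_order all_algebra.
From mathcomp Require Import complex ring lra.
From mathcomp Require Import all_classical all_reals all_analysis.
From mathcomp Require Import measurable_realfun.

Set Implicit Arguments.
Unset Strict Implicit.
Unset Printing Implicit Defensive.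

Import Order.TTheory GRing.Theory Num.Theory.
Import numFieldNormedType.Exports.

Local Open Scope classical_set_scope.
Local Open Scope ring_scope.

(* The library has the square-integrable functions [LfunType mu _] but no
   vector space of classes; [L2 mu] is their quotient by a.e. equality. *)
Section L2_space.
Context {d : measure_display} {T : measurableType d} {R : realType}.
Variable mu : {measure set T -> \bar R}.

Local Notation Lfun2 := (LfunType mu (lee1n 2)).

Definition ae_zero : {pred Lfun2} :=
  fun f => `[< \forall x \ae mu, f x = 0 >].

Fact ae_zero_zmod_closed : zmod_closed ae_zero.
Proof.
split=> [|f g /asboolP f0 /asboolP g0]; apply/asboolP; first exact: aeW.
by apply: filterS2 f0 g0 => x fx gx; rewrite -[LHS]/(f x - g x) fx gx subr0.
Qed.

HB.instance Definition _ :=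
  GRing.isZmodClosed.Build Lfun2 ae_zero ae_zero_zmod_closed.

Definition L2 : Type := Quotient.quot ae_zero.

HB.instance Definition _ := GRing.Zmodule.on L2.

Local Open Scope quotient_scope.

Definition L2_class (f : Lfun2) : L2 := \pi_(Quotient.quot ae_zero) f.

(* a representative of the class *)
Definition L2_repr (f : L2) : Lfun2 := repr (f : Quotient.quot ae_zero).

Lemma L2_reprK : cancel L2_repr L2_class.
Proof. by move=> f; rewrite /L2_class /L2_repr reprK. Qed.

Lemma L2_classP (f g : Lfun2) :
  (L2_class f = L2_class g) <-> (\forall x \ae mu, f x = g x).
Proof.
split=> [/eqP|fg].
  rewrite /L2_class -Quotient.idealrBE => /asboolP.
  by apply: filterS => x /= /eqP; rewrite subr_eq0 => /eqP.
apply/eqP; rewrite /L2_class -Quotient.idealrBE; apply/asboolP.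
by apply: filterS fg => x fg; rewrite -[LHS]/(f x - g x) fg subrr.
Qed.

Lemma L2_classD : {morph L2_class : f g / f + g}.
Proof. by move=> f g; rewrite /L2_class -[RHS]raddfD. Qed.

Lemma L2_reprE (f : Lfun2) : \forall x \ae mu, L2_repr (L2_class f) x = f x.
Proof. by apply/L2_classP; rewrite L2_reprK. Qed.

Definition L2_scale (a : R) (f : L2) : L2 := L2_class (a *: L2_repr f).

Lemma L2_classZ a f : L2_class (a *: f) = L2_scale a (L2_class f).
Proof.
apply/L2_classP; apply: filterS (L2_reprE f) => x fx.
by rewrite -[LHS]/(a * f x) -[RHS]/(a * L2_repr _ x) fx.
Qed.

Fact L2_scaleA a b f : L2_scale a (L2_scale b f) = L2_scale (a * b) f.
Proof. by rewrite -[f]L2_reprK -!L2_classZ scalerA. Qed.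

Fact L2_scale1 : left_id 1 L2_scale.
Proof. by move=> f; rewrite -[f]L2_reprK -L2_classZ scale1r. Qed.

Fact L2_scaleDr : right_distributive L2_scale +%R.
Proof.
move=> a f g; rewrite -[f]L2_reprK -[g]L2_reprK.
by rewrite -L2_classD -!L2_classZ scalerDr L2_classD.
Qed.

Fact L2_scaleDl f : {morph L2_scale^~ f : a b / a + b}.
Proof.
by move=> a b; rewrite -[f]L2_reprK -!L2_classZ scalerDl L2_classD.
Qed.

HB.instance Definition _ := GRing.Zmodule_isLmodule.Build R L2
  L2_scaleA L2_scale1 L2_scaleDr L2_scaleDl.

Definition L2_norm (f : L2) : R := fine ('N[mu]_2[EFin \o L2_repr f])%E.

Lemma L2_norm_class f : L2_norm (L2_class f) = fine ('N[mu]_2[EFin \o f])%E.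
Proof.
rewrite /L2_norm unlock; congr (fine (_ `^ _))%E.
apply: ae_eq_integral => //.
- apply: (measurableT_comp (measurable_poweR _)); apply: measurableT_comp => //.
  exact/measurable_EFinP.
- apply: (measurableT_comp (measurable_poweR _)); apply: measurableT_comp => //.
  exact/measurable_EFinP.
by apply: filterS (L2_reprE f) => x /= -> _.
Qed.

Fact L2_ler_normD f g : L2_norm (f + g) <= L2_norm f + L2_norm g.
Proof.
rewrite -[f]L2_reprK -[g]L2_reprK -L2_classD !L2_norm_class.
exact: ler_LnormD.
Qed.

Fact L2_normrZ (a : R) f : L2_norm (a *: f) = `|a| * L2_norm f.
Proof.
rewrite -[f]L2_reprK -[a *: _]L2_classZ !L2_norm_class.
by rewrite LnormZ fineM// -finite_norm_fine.
Qed.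

Fact L2_normr0_eq0 f : L2_norm f = 0 -> f = 0.
Proof.
rewrite -[f]L2_reprK L2_norm_class => /fine_Lnormr_eq0 f0.
have -> : (0 : L2) = L2_class 0 by rewrite /L2_class raddf0.
by apply/L2_classP; apply: filterS f0 => x; apply.
Qed.

HB.instance Definition _ := Lmodule_isNormed.Build R L2
  L2_ler_normD L2_normrZ L2_normr0_eq0.

Definition L2_dot (f g : L2) : R := \int[mu]_x (L2_repr f x * L2_repr g x).

End L2_space.

Fact euclidean_triangle (K : rcfType) (a b c e : K) :
  Num.sqrt ((a + c) ^+ 2 + (b + e) ^+ 2) <=
  Num.sqrt (a ^+ 2 + b ^+ 2) + Num.sqrt (c ^+ 2 + e ^+ 2).
Proof.
have n0 (x y : K) : 0 <= x ^+ 2 + y ^+ 2 by rewrite addr_ge0 ?sqr_ge0.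
have s0 (x y : K) : 0 <= Num.sqrt (x ^+ 2 + y ^+ 2) by exact: sqrtr_ge0.
have H : a * c + b * e <= Num.sqrt (a ^+ 2 + b ^+ 2) * Num.sqrt (c ^+ 2 + e ^+ 2).
  rewrite -sqrtrM//; apply: (le_trans (ler_norm _)).
  rewrite -sqrtr_sqr ler_wsqrtr// -subr_ge0.
  have -> : (a ^+ 2 + b ^+ 2) * (c ^+ 2 + e ^+ 2) - (a * c + b * e) ^+ 2 =
    (a * e - b * c) ^+ 2 by ring.
  exact: sqr_ge0.
have := sqr_sqrtr (n0 a b); have := sqr_sqrtr (n0 c e).
have := sqr_sqrtr (n0 (a + c) (b + e)); move: H (s0 a b) (s0 c e).
move: (Num.sqrt _) (Num.sqrt _) (s0 (a + c) (b + e)) => u v.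
move: (Num.sqrt _) => w w0 H u0 v0 w2 v2 u2; nra.
Qed.

Arguments L2_dot {d T R mu} f g.

(* The complexification of [L2 mu], with [f.1] the real and [f.2] the imaginary
   part, regarded as a real normed space. *)
Section complex_L2_space.
Context {d : measure_display} {T : measurableType d} {R : realType}.
Variable mu : {measure set T -> \bar R}.

Definition CL2 : Type := (L2 mu * L2 mu)%type.

HB.instance Definition _ := GRing.Lmodule.copy CL2 (L2 mu * L2 mu)%type.

Definition CL2_norm (f : CL2) : R := Num.sqrt (`|f.1| ^+ 2 + `|f.2| ^+ 2).

Fact CL2_ler_normD f g : CL2_norm (f + g) <= CL2_norm f + CL2_norm g.
Proof.
apply: le_trans (euclidean_triangle _ _ _ _); apply: ler_wsqrtr; apply: lerD;
  by rewrite ler_pXn2r ?nnegrE ?addr_ge0//; exact: ler_normD.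
Qed.

Fact CL2_normrZ (a : R) f : CL2_norm (a *: f) = `|a| * CL2_norm f.
Proof.
rewrite /CL2_norm /= !normrZ !exprMn -mulrDr sqrtrM ?sqr_ge0//.
by rewrite sqrtr_sqr normr_id.
Qed.

Fact CL2_normr0_eq0 f : CL2_norm f = 0 -> f = 0.
Proof.
move=> /eqP; rewrite sqrtr_eq0 => f0.
have /eqP : `|f.1| ^+ 2 + `|f.2| ^+ 2 = 0.
  by apply/eqP; rewrite eq_le f0 addr_ge0// sqr_ge0.
rewrite paddr_eq0 ?sqr_ge0// !sqrf_eq0 !normr_eq0.
by case: f {f0} => f1 f2 /= /andP[/eqP-> /eqP->].
Qed.

HB.instance Definition _ := Lmodule_isNormed.Build R CL2
  CL2_ler_normD CL2_normrZ CL2_normr0_eq0.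

Definition CL2_cscale (z : R[i]) (f : CL2) : CL2 :=
  (complex.Re z *: f.1 - complex.Im z *: f.2,
   complex.Im z *: f.1 + complex.Re z *: f.2).

(* [\int f * conj g] *)
Definition CL2_cdot (f g : CL2) : R[i] :=
  Complex (L2_dot f.1 g.1 + L2_dot f.2 g.2) (L2_dot f.2 g.1 - L2_dot f.1 g.2).

Definition CL2_dot (f g : CL2) : R := complex.Re (CL2_cdot f g).

End complex_L2_space.

Arguments CL2_cdot {d T R mu} f g.
Arguments CL2_dot {d T R mu} f g.

Section function_spaces.
Context (R : realType).

Definition mu0pi : {measure set (measurableTypeR R) -> \bar R} :=
  mrestr (@lebesgue_measure R) (measurable_itv `]0, pi[).

Definition U0 : Type := L2 mu0pi.
Definition H0 : Type := CL2 mu0pi.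

Definition sine (k : nat) (x : R) : R := Num.sqrt (2 / pi) * sin (k%:R * x).

Fact sine_Lfun k : (sine k : measurableTypeR R -> R) \in Lfun mu0pi 2%:E.
Proof.
have cs : continuous (sine k : R -> R).
  move=> x; rewrite /sine; apply: cvgM; first exact: cvg_cst.
  apply: (@cvg_comp _ _ _ ( *%R k%:R) sin); last exact: continuous_sin.
  by apply: cvgM; [exact: cvg_cst|exact: cvg_id].
have ms : measurable_fun [set: measurableTypeR R] (sine k).
  exact: continuous_measurable_fun.
rewrite inE; apply/andP; split; rewrite inE//=.
rewrite /finite_norm unlock poweR_lty//.
apply: (@le_lt_trans _ _ (\int[mu0pi]_x (cst ((Num.sqrt (2 / pi)) `^ 2)%:E x))%E).
  apply: ge0_le_integral => //.
  - by move=> x _; exact: poweR_ge0.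
  - apply: (measurableT_comp (measurable_poweR _)); apply: measurableT_comp => //.
    exact/measurable_EFinP.
  - move=> x _ /=; rewrite lee_fin ge0_ler_powR ?nnegrE//.
    rewrite normrM ger0_norm ?sqrtr_ge0// ler_piMr ?sqrtr_ge0//.
    by rewrite ler_norml sin_geN1 sin_le1.
rewrite integral_cst//= lte_mul_pinfty ?lee_fin ?powR_ge0//.
rewrite /mrestr setTI lebesgue_measure_itv /= lte_fin pi_gt0.
by rewrite -EFinB ltry.
Qed.

Definition e_ (k : nat) : U0 := L2_class (Lfun_Sub (lee1n 2) (sine_Lfun k)).

(* [e_ k] as a complex function *)
Definition ec_ (k : nat) : H0 := (e_ k, 0).

(* Smooth functions on the line with compact support in (0, pi). *)
Definition test_function (phi : R -> R) : Prop :=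
  (forall n x, derivable (derive1n n phi) x 1) /\
  (exists a b : R, [/\ 0 < a, b < pi & forall x, ~ (a <= x <= b) -> phi x = 0]).

Definition weak_derivative (f g : U0) : Prop :=
  forall phi, test_function phi ->
    \int[mu0pi]_x (L2_repr f x * derive1 phi x) =
    - \int[mu0pi]_x (L2_repr g x * phi x).

Definition U1 : set U0 := [set f | exists g, weak_derivative f g].

(* Squared norm of H^1(0, pi; R); the infimum is over at most one value, and is
   [+oo] when [f] is not in [U1]. *)
Definition U1_sqnorm (f : U0) : \bar R :=
  ereal_inf [set (`|f| ^+ 2 + `|g| ^+ 2)%:E | g in weak_derivative f].

(* The continuous representative vanishes at both ends. *)
Definition zero_boundary (f : U0) : Prop :=
  exists F : R -> R, [/\ {within `[0, pi], continuous F},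
    \forall x \ae mu0pi, L2_repr f x = F x, F 0 = 0 & F pi = 0].

Definition U10 : set U0 := U1 `&` zero_boundary.
Definition H10 : set H0 := [set f | U10 f.1 /\ U10 f.2].

(* [f] is in the domain H^2 `&` H^1_0 and [g] is its second derivative. *)
Definition real_dirichlet_laplacian (f g : U0) : Prop :=
  U10 f /\ exists2 h, weak_derivative f h & weak_derivative h g.

(* An operator defined everywhere that is the Dirichlet Laplacian on the domain
   of the latter; its values elsewhere are irrelevant. *)
Definition is_dirichlet_laplacian (Delta : H0 -> H0) : Prop :=
  forall f g : H0, real_dirichlet_laplacian f.1 g.1 ->
    real_dirichlet_laplacian f.2 g.2 -> Delta f = g.

End function_spaces.

Arguments e_ {R} k.
Arguments ec_ {R} k.

Section operators.
Context {R : realType}.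

Definition nonneg_symmetric (V : lmodType R) (dot : V -> V -> R)
    (A : V -> V) : Prop :=
  (forall f g, dot (A f) g = dot f (A g)) /\ (forall f, 0 <= dot (A f) f).

(* [B] is the nonnegative symmetric square root of [A]. *)
Definition is_sqrt_operator (V : lmodType R) (dot : V -> V -> R)
    (A B : V -> V) : Prop :=
  nonneg_symmetric dot B /\ (forall f, B (B f) = A f).

Definition orthonormal_basis (b : nat -> U0 R) : Prop :=
  (forall i j, L2_dot (b i) (b j) = (i == j)%:R) /\
  (forall f, (forall i, L2_dot f (b i) = 0) -> f = 0).

Definition hilbert_schmidt_U0_U1 (A : U0 R -> U0 R) : Prop :=
  (exists C : R, forall f, (U1_sqnorm (A f) <= (C * `|f| ^+ 2)%:E)%E) /\
  (exists2 b, orthonormal_basis b &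
    (\sum_(0 <= i <oo) U1_sqnorm (A (b i)) < +oo)%E).

Definition complexify (A : U0 R -> U0 R) (f : H0 R) : H0 R := (A f.1, A f.2).

Definition H_ (M : nat) : set (H0 R) :=
  [set x | exists c : nat -> R[i],
    x = \sum_(1 <= k < M.+1) CL2_cscale (c k) (ec_ k)].

Definition P_ (M : nat) (x : H0 R) : H0 R :=
  \sum_(1 <= k < M.+1) CL2_cscale (CL2_cdot x (ec_ k)) (ec_ k).

(* Minimal-norm preimage in [H_ M], with value 0 where there is none. *)
Definition pseudo_inverse (M : nat) (A : H0 R -> H0 R) (x : H0 R) : H0 R :=
  xget 0 [set z | [/\ H_ M z, A z = x &
    forall z', H_ M z' -> A z' = x -> `|z| <= `|z'|]].

Definition galerkin_rate (M : nat) (alpha : R) (QMhalf : H0 R -> H0 R)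
    (x : H0 R) : \bar R :=
  if x \in range QMhalf then
    ((alpha ^+ 2)^-1 * `|pseudo_inverse M QMhalf x| ^+ 2)%:E
  else +oo%E.

End operators.

Section stochastics.
Context {R : realType} {d : measure_display} {Omega : measurableType d}.
Variable P : probability Omega R.

Definition filtration (F : R -> set (set Omega)) : Prop :=
  (forall t : R, 0 <= t ->
    sigma_algebra [set: Omega] (F t) /\ F t `<=` measurable) /\
  (forall s t : R, 0 <= s -> s <= t -> F s `<=` F t).

Definition usual_conditions (F : R -> set (set Omega)) : Prop :=
  [/\ measure_is_complete P, P.-negligible `<=` F 0 &
    forall t : R, 0 <= t -> \bigcap_(s in [set s | t < s]) F s `<=` F t].

Definition brownian_motion (F : R -> set (set Omega)) (B : R -> Omega -> R) :
    Prop :=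
  [/\ forall t : R, 0 <= t -> forall A, measurable A -> F t (B t @^-1` A),
      \forall w \ae P, B 0 w = 0,
      \forall w \ae P, {within `[0, +oo[, continuous (B ^~ w)},
      forall s t : R, 0 <= s -> s < t -> forall A, measurable A ->
        P ((fun w => B t w - B s w)%R @^-1` A) =
        normal_prob 0 (Num.sqrt (t - s)) A &
      forall s t : R, 0 <= s -> s < t -> forall A E, measurable A -> F s E ->
        P (((fun w => B t w - B s w)%R @^-1` A) `&` E) =
        (P ((fun w => B t w - B s w)%R @^-1` A) * P E)%E].

Definition process_sigma (B : R -> Omega -> R) : set (set Omega) :=
  <<s [set X | exists (t : R) A, [/\ 0 <= t, measurable A & X = B t @^-1` A]] >>.

(* For the processes of index [k >= 1]; a subfamily is obtained with [X k := setT]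
   for the other indices. *)
Definition independent_processes (B : nat -> R -> Omega -> R) : Prop :=
  forall (n : nat) (X : nat -> set Omega),
    (forall k, (1 <= k <= n)%N -> process_sigma (B k) (X k)) ->
    P (\bigcap_(k in [set k | (1 <= k <= n)%N]) X k) =
    (\prod_(1 <= k < n.+1) P (X k))%E.

(* Almost surely, the series of the Q-Wiener process converges to [W t] in [U0],
   for all [t] simultaneously. *)
Definition is_wiener_series (eta : nat -> R) (B : nat -> R -> Omega -> R)
    (W : R -> Omega -> U0 R) : Prop :=
  \forall w \ae P, forall t : R, 0 <= t ->
    (fun n => \sum_(1 <= k < n.+1) (Num.sqrt (eta k) * B k t w) *: e_ k)
      @ \oo --> W t w.

(* [v] is the weak integral of [f] over [[0, t]]. *)
Definition is_integral (f : R -> H0 R) (t : R) (v : H0 R) : Prop :=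
  forall h : H0 R,
    lebesgue_measure.-integrable `[0, t] (fun s => (CL2_dot (f s) h)%:E) /\
    CL2_dot v h = \int[lebesgue_measure]_(s in `[0, t]) CL2_dot (f s) h.

(* [u] is an adapted continuous solution with values in [H_ M] of
   [u t = P_ M u0 + \int_0^t i Delta (P_ M (u s)) ds + i alpha P_ M (W t)];
   the noise being additive, no stochastic integral is involved. *)
Definition galerkin_solution (F : R -> set (set Omega)) (alpha : R)
    (Delta : H0 R -> H0 R) (W : R -> Omega -> U0 R) (u0 : H0 R) (M : nat)
    (u : R -> Omega -> H0 R) : Prop :=
  [/\ forall t : R, 0 <= t -> forall G, open G -> F t (u t @^-1` G),
      forall (t : R) w, 0 <= t -> H_ M (u t w),
      \forall w \ae P, {within `[0, +oo[, continuous (u ^~ w)} &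
      \forall w \ae P, forall t : R, 0 <= t -> exists2 v,
        is_integral (fun s => CL2_cscale 'i%C (Delta (P_ M (u s w)))) t v &
        u t w = P_ M u0 + v
          + CL2_cscale ('i * alpha%:C)%C (P_ M ((W t w, 0) : H0 R))].

Context {X : topologicalType}.

Definition rate_function (I : X -> \bar R) : Prop :=
  (forall x, (0 <= I x)%E) /\ lower_semicontinuous I.

Definition good_rate_function (I : X -> \bar R) : Prop :=
  rate_function I /\
  (forall a : R, 0 <= a -> compact [set x | (I x <= a%:E)%E]).

Local Open Scope ereal_scope.

Definition satisfies_ldp (Z : R -> Omega -> X) (I : X -> \bar R) : Prop :=
  [/\ rate_function I,
      forall T : R, (0 < T)%R -> forall G, open G -> measurable (Z T @^-1` G),
      forall G : set X, open G ->
        - ereal_inf (I @` G) <=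
        limf_einf (fun T : R => T^-1%:E * lne (P (Z T @^-1` G))) (pinfty_nbhs R) &
      forall C : set X, closed C ->
        limf_esup (fun T : R => T^-1%:E * lne (P (Z T @^-1` C))) (pinfty_nbhs R)
        <= - ereal_inf (I @` C)].

End stochastics.

(* Main.v *)
(** In real coordinates the Galerkin solution is a family of [M] driven harmonic
    oscillators.  Summation by parts turns each solution at time [T] into a
    pathwise limit of Riemann sums of Brownian increments weighted by a rotating
    phase, so no stochastic integral is needed.  The exponential moments of these
    sums are explicit; in the limit the phase averages to one half, whence
    [E exp (theta . X_T) = exp (T * Lambda theta + O(1))], where
    [Lambda theta = 1/2 \sum_i a_i theta_i ^ 2] and
    [a_i = alpha ^ 2 * eta (mode i) / 2].  For a diagonal quadratic form the
    Gärtner-Ellis theorem needs no change of measure: half-spaces give the upper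
    bound, and for the lower bound the mass of [exp (u . X_T)] outside a box is
    dominated by finitely many exponential moments at nearby parameters, which
    are exponentially smaller.  The Legendre transform of [Lambda], carried to
    [H_ M], is the rate function. *)

Require Import Defs.
From mathcomp Require Import all_boot all_order all_algebra.
From mathcomp Require Import complex ring lra.
From mathcomp Require Import all_classical all_reals all_analysis.
From mathcomp Require Import measurable_realfun.

Set Implicit Arguments.
Unset Strict Implicit.
Unset Printing Implicit Defensive.

Import Order.TTheory GRing.Theory Num.Theory.
Import numFieldNormedType.Exports.

Local Open Scope classical_set_scope.
Local Open Scope ring_scope.

(** * Large deviations with a diagonal quadratic cumulant limit *)

Section quadratic_forms.
Context {R : realType} {n : nat}.
Implicit Types (u v : 'rV[R]_n) (a : 'I_n -> R).

(** A mode has real coordinates (x, y) with x' = l y and y' = - l x + noise. The noise enters only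
    y, and the rotation spreads it evenly over both coordinates. Hence the second factor 1/2 in a_i,
    which turns the usual Gaussian rate with 1 / (2 alpha^2) into the sum of v_i^2 / (alpha^2 eta),
    with prefactor 1 / alpha^2. Two obstacles shape the estimates. Modes with eta = 0 make the
    quadratic form degenerate and its Legendre transform infinite off a subspace, so both bounds are
    phrased with finitely many linear functionals, which works for degenerate forms as well.
    Moreover, the solution is only an almost sure limit of sums of increments, and exponential
    moments need not pass to such a limit. What rescues them is that the second moment of the
    exponential is again an explicit exponential moment, at the doubled parameter, which gives
    uniform integrability. The initial value and the oscillating part of the variance stay bounded
    in T and enter only the O(1) term. *)

Definition rv_dot u v : R := \sum_i u 0 i * v 0 i.

Lemma rv_dotDl u u' v : rv_dot (u + u') v = rv_dot u v + rv_dot u' v.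
Proof.
by rewrite -big_split/=; apply: eq_bigr => i _; rewrite mxE mulrDl.
Qed.

Lemma rv_dotZl c u v : rv_dot (c *: u) v = c * rv_dot u v.
Proof. by rewrite mulr_sumr; apply: eq_bigr => i _; rewrite mxE mulrA. Qed.

Lemma rv_dotZr c u v : rv_dot u (c *: v) = c * rv_dot u v.
Proof. by rewrite mulr_sumr; apply: eq_bigr => i _; rewrite mxE mulrCA. Qed.

Lemma rv_dot_delta i v : rv_dot (delta_mx 0 i) v = v 0 i.
Proof.
rewrite /rv_dot (bigD1 i)//= big1 ?addr0 => [|j ji]; first by rewrite mxE !eqxx mul1r.
by rewrite mxE (negbTE ji) andbF mul0r.
Qed.

Lemma continuous_rv_dot u : continuous (rv_dot u).
Proof.
apply: (continuous_big (@add_continuous _)) => i _ v.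
apply: (@continuousM _ _ (cst (u 0 i)) (fun x : 'rV[R]_n => x 0 i)).
  exact: cst_continuous.
exact: coord_continuous.
Qed.

Definition diag_form a u : R := (\sum_i a i * u 0 i ^+ 2) / 2.

(** The Legendre transform of [diag_form a]. Since [0^-1 = 0], the sum alone would ignore the
    coordinates with [a i = 0], where a nonzero [v 0 i] must cost +oo; hence the test. *)
Definition diag_legendre a v : \bar R :=
  if [forall i, (a i == 0) ==> (v 0 i == 0)] then
    ((\sum_i (a i)^-1 * v 0 i ^+ 2) / 2)%:E
  else +oo%E.

Lemma diag_legendre_ge0 a v : (forall i, 0 <= a i) ->
  (0 <= diag_legendre a v)%E.
Proof.
move=> a0; rewrite /diag_legendre; case: ifP => // _.
rewrite lee_fin divr_ge0// sumr_ge0// => i _.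
by rewrite mulr_ge0 ?sqr_ge0// invr_ge0.
Qed.

(* The maximizer in the Legendre transform. *)
Definition dual_rv a v : 'rV[R]_n := \row_i ((a i)^-1 * v 0 i).

(** This is stationarity of u . v - [diag_form a u]. It survives at [a i = 0], because finiteness of
    the transform forces [v 0 i = 0] there. *)
Lemma dual_rvE a v i : diag_legendre a v != +oo%E ->
  a i * dual_rv a v 0 i = v 0 i.
Proof.
rewrite /diag_legendre; case: ifP => // /forallP/(_ i) h _.
rewrite mxE; have [ai|ai] := eqVneq (a i) 0; last by rewrite mulVKf.
by move: h; rewrite ai eqxx/= mul0r => /eqP ->.
Qed.

Lemma diag_legendre_dual a v : diag_legendre a v != +oo%E ->
  diag_legendre a v =
    (rv_dot (dual_rv a v) v - diag_form a (dual_rv a v))%:E.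
Proof.
move=> h; have aE i := dual_rvE i h; move: h; rewrite {1}/diag_legendre.
rewrite /diag_legendre; case: ifP => // _ _; congr EFin.
rewrite /rv_dot /diag_form.
have -> : \sum_i a i * dual_rv a v 0 i ^+ 2 = \sum_i (a i)^-1 * v 0 i ^+ 2.
  by apply: eq_bigr => i _; rewrite expr2 mulrA aE mxE; ring.
have -> : \sum_i dual_rv a v 0 i * v 0 i = \sum_i (a i)^-1 * v 0 i ^+ 2.
  by apply: eq_bigr => i _; rewrite mxE; ring.
lra.
Qed.

Lemma diag_form_delta a i c : diag_form a (c *: delta_mx 0 i) = a i * c ^+ 2 / 2.
Proof.
rewrite /diag_form (bigD1 i)//= big1 => [|j ji].
  by rewrite !mxE !eqxx mulr1 addr0.
by rewrite !mxE (negbTE ji) andbF mulr0 expr0n mulr0.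
Qed.

Lemma diag_form_addZ a u i c :
  diag_form a (u + c *: delta_mx 0 i) =
  diag_form a u + c * (a i * u 0 i) + a i * c ^+ 2 / 2.
Proof.
rewrite -(diag_form_delta a i c) /diag_form.
have -> : \sum_j a j * (u + c *: delta_mx 0 i) 0 j ^+ 2 =
    \sum_j a j * u 0 j ^+ 2 + \sum_j a j * (c *: delta_mx 0 i : 'rV[R]_n) 0 j ^+ 2 +
    (c * 2) * rv_dot (delta_mx 0 i) (\row_j (a j * u 0 j)).
  rewrite mulr_sumr -!big_split/=; apply: eq_bigr => j _; rewrite !mxE; ring.
rewrite rv_dot_delta mxE; lra.
Qed.

(** If the transform is finite, the maximizer will do. If it is infinite, some coordinate has
    [a i = 0] and [v 0 i != 0]: along it the linear part is unbounded at no quadratic cost. *)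
Lemma lt_diag_legendre a v (l : R) : (l%:E < diag_legendre a v)%E ->
  exists u, l < rv_dot u v - diag_form a u.
Proof.
have [J|J] := eqVneq (diag_legendre a v) +oo%E; last first.
  by rewrite diag_legendre_dual// lte_fin => ?; exists (dual_rv a v).
move=> _; move: J; rewrite /diag_legendre; case: ifPn => //.
move=> nz _; have [i ai vi] : exists2 i, a i = 0 & v 0 i != 0.
  apply: contrapT => h; case/negP: nz; apply/forallP => i; apply/implyP.
  by move=> /eqP ai; apply: contrapT => /negP vi; apply: h; exists i.
exists (((l + 1) / v 0 i) *: delta_mx 0 i).
rewrite diag_form_delta ai rv_dotZl rv_dot_delta divfK//; lra.
Qed.

(** Completing the square: with z the maximizer, the deficit at u is exactly [diag_form a (u - z)],
    which is nonnegative. *)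
Lemma fenchel_young a u v (l : R) : (forall i, 0 <= a i) ->
  (diag_legendre a v <= l%:E)%E -> rv_dot u v - diag_form a u <= l.
Proof.
move=> a0 vl; have J : diag_legendre a v != +oo%E.
  by rewrite lt_eqF// (le_lt_trans vl)// ltry.
move: vl; rewrite diag_legendre_dual// lee_fin; apply: le_trans.
set z := dual_rv a v; have zE j : a j * z 0 j = v 0 j by exact: dual_rvE.
rewrite -subr_ge0; suff <- : diag_form a (u - z) = (rv_dot z v - diag_form a z) -
    (rv_dot u v - diag_form a u).
  by rewrite divr_ge0// sumr_ge0// => j _; rewrite mulr_ge0// sqr_ge0.
rewrite /diag_form /rv_dot.
have -> : \sum_j a j * (u - z) 0 j ^+ 2 =
    \sum_j a j * u 0 j ^+ 2 + \sum_j a j * z 0 j ^+ 2 - 2 * \sum_j u 0 j * v 0 j.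
  rewrite mulr_sumr -sumrN -!big_split/=; apply: eq_bigr => j _.
  by rewrite -zE [(u - _) 0 j]mxE [X in u 0 j + X]mxE; ring.
have -> : \sum_j a j * z 0 j ^+ 2 = \sum_j z 0 j * v 0 j.
  by apply: eq_bigr => j _; rewrite -zE; ring.
by field.
Qed.

(** Testing [fenchel_young] against plus and minus the j-th unit vector gives |v_j| <= l + a_j / 2,
    hence boundedness. Closedness holds because the sublevel set is an intersection of closed
    half-spaces, one for each u. *)
Lemma diag_legendre_sublevel_compact a (l : R) : (forall i, 0 <= a i) ->
  compact [set v : 'rV[R]_n | (diag_legendre a v <= l%:E)%E].
Proof.
move=> a0; apply: bounded_closed_compact.
  exists (`|l| + (\sum_i a i) / 2); split; first exact: num_real.
  move=> K LK v vl.
  have K0 : 0 <= K.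
    by apply: le_trans (ltW LK); rewrite addr_ge0// divr_ge0// sumr_ge0.
  rewrite /= /Num.norm/= mx_normrE; apply/bigmax_leP; split => //= -[i j] _ /=.
  rewrite ord1 {i}; have aj : a j <= \sum_i a i.
    by rewrite (bigD1 j)//= lerDl sumr_ge0.
  have := fenchel_young ((-1) *: delta_mx 0 j) a0 vl.
  have := fenchel_young (1 *: delta_mx 0 j) a0 vl.
  rewrite !diag_form_delta !rv_dotZl !rv_dot_delta sqrrN !expr1n.
  have := ler_norm l; rewrite ler_norml; lra.
have -> : [set v : 'rV[R]_n | (diag_legendre a v <= l%:E)%E] =
    \bigcap_(u in [set: 'rV[R]_n]) [set v | rv_dot u v - diag_form a u <= l].
  apply/seteqP; split => v /=.
    by move=> vl u _ /=; exact: fenchel_young.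
  move=> h; rewrite leNgt; apply/negP => /lt_diag_legendre[u].
  by have := h u I; rewrite /= ltNge => ->.
apply: closed_bigI => u _.
have -> : [set v | rv_dot u v - diag_form a u <= l] =
    rv_dot u @^-1` [set x | x <= l + diag_form a u].
  by apply/seteqP; split => v /=; rewrite lerBlDr.
apply: preimage_closed => [v _|]; last exact: closed_le.
exact: continuous_rv_dot.
Qed.

End quadratic_forms.

(** * Probability bounds from exponential moments *)

Section exponential_estimates.
Context {R : realType} {d : measure_display} {Omega : measurableType d}.
Variables (P : probability Omega R) (n : nat) (a : 'I_n -> R).
Variable X : R -> Omega -> 'rV[R]_n.
Hypothesis a_ge0 : forall i, 0 <= a i.
Hypothesis mX : forall T, 0 < T -> forall i,
  measurable_fun [set: Omega] (fun w => X T w 0 i).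
Hypothesis X_mgf : forall u, exists C : R, forall T, 0 < T ->
  ((expR (T * diag_form a u - C))%:E <=
     \int[P]_w (expR (rv_dot u (X T w)))%:E <=
   (expR (T * diag_form a u + C))%:E)%E.

Lemma measurable_rv_dot u T : 0 < T ->
  measurable_fun [set: Omega] (fun w => rv_dot u (X T w)).
Proof.
move=> T0; apply: measurable_sum => i.
by apply: measurable_funM => //; exact: mX.
Qed.

Lemma measurable_expR_rv_dot u T c : 0 < T ->
  measurable_fun [set: Omega] (fun w => (expR (rv_dot u (X T w) + c))%:E).
Proof.
move=> T0; apply/measurable_EFinP; apply: measurableT_comp => //.
by apply: measurable_funD => //; exact: measurable_rv_dot.
Qed.

Lemma integral_expR_rv_dotD u T c : 0 < T ->
  (\int[P]_w (expR (rv_dot u (X T w) + c))%:E =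
   (expR c)%:E * \int[P]_w (expR (rv_dot u (X T w)))%:E)%E.
Proof.
move=> T0; rewrite -ge0_integralZl//.
- by apply: eq_integral => w _; rewrite -EFinM -expRD addrC.
- have := measurable_expR_rv_dot u 0 T0.
  by under eq_fun do rewrite addr0.
Qed.

Lemma le_prob_integral (A : set Omega) (c : R) (h : Omega -> \bar R) :
  0 <= c -> measurable A -> measurable_fun [set: Omega] h ->
  (forall w, 0 <= h w)%E -> (forall w, A w -> c%:E <= h w)%E ->
  (c%:E * P A <= \int[P]_w h w)%E.
Proof.
move=> c0 mA mh h0 Ah.
apply: (@le_trans _ _ (\int[P]_(w in A) h w)%E); last first.
  by apply: ge0_subset_integral.
rewrite -integral_cst//; apply: ge0_le_integral => //.
exact: measurable_funTS mh.
Qed.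

(** The constants [K] are fixed before [T] and the shifts [c], because the applications let the
    shifts depend on [T]. *)
Lemma integral_sum_expR_le (I : Type) (s : seq I) (u : I -> 'rV[R]_n) :
  exists K : I -> R, forall T (c : I -> R), 0 < T ->
    (\int[P]_w (\sum_(i <- s) (expR (rv_dot (u i) (X T w) + c i))%:E) <=
     (\sum_(i <- s) expR (T * diag_form a (u i) + c i) * K i)%:E)%E.
Proof.
have /choice[C hC] : forall i, exists C : R, forall T, 0 < T ->
    (\int[P]_w (expR (rv_dot (u i) (X T w)))%:E <=
     (expR (T * diag_form a (u i) + C))%:E)%E.
  by move=> i; have [C hC] := X_mgf (u i); exists C => T /hC /andP[].
exists (fun i => expR (C i)) => T c T0; rewrite ge0_integral_sum//.
- rewrite -sumEFin; apply: lee_sum => i _.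
  rewrite integral_expR_rv_dotD//.
  apply: (@le_trans _ _
      ((expR (c i))%:E * (expR (T * diag_form a (u i) + C i))%:E)%E).
    by rewrite lee_pmul2l ?lte_fin ?expR_gt0//; exact: hC.
  rewrite -EFinM lee_fin -!expRD le_eqVlt; apply/orP; left; apply/eqP.
  by congr expR; ring.
- by move=> i; exact: measurable_expR_rv_dot.
Qed.

(** A Chernoff bound, summed over a finite cover of [S] by half-spaces. It is stated for any
    measurable [A] on which the scaled variable lies in [S], so that measurability of the event
    itself is left to the caller. *)
Lemma half_space_cover_prob (S : set 'rV[R]_n) (l : R) (s : seq 'rV[R]_n) :
  (forall v, S v -> exists2 u, u \in s & l <= rv_dot u v - diag_form a u) ->
  exists K : R, forall T A, 0 < T -> measurable A ->
    (forall w, A w -> S (T^-1 *: X T w)) -> (P A <= (K * expR (- (T * l)))%:E)%E.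
Proof.
move=> hS; have [K hK] := integral_sum_expR_le s id.
exists (\sum_(u <- s) K u) => T A T0 mA AS.
(* With this shift the exponential is at least 1 on the half-space of u, while its integral is at
   most a constant times exp (- T l). *)
pose c u := - (T * diag_form a u) - T * l.
have h0 u w : (0 <= (expR (rv_dot u (X T w) + c u))%:E)%E.
  by rewrite lee_fin expR_ge0.
rewrite -[P A]mul1e.
apply: (le_trans (@le_prob_integral A 1 (fun w =>
  \sum_(u <- s) (expR (rv_dot u (X T w) + c u))%:E)%E ler01 mA _ _ _)).
- by apply: emeasurable_sum => u; exact: measurable_expR_rv_dot.
- by move=> w; apply: sume_ge0.
- move=> w /AS /hS[u us lu]; rewrite (big_rem u)//=.
  apply: (@le_trans _ _ (expR (rv_dot u (X T w) + c u))%:E); last first.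
    by rewrite leeDl// sume_ge0.
  rewrite lee_fin -expR0 ler_expR /c.
  move: lu; rewrite rv_dotZr lerBrDr mulrC ler_pdivlMr//; lra.
apply: (le_trans (hK _ _ T0)); rewrite lee_fin mulr_suml le_eqVlt; apply/orP; left.
apply/eqP/eq_bigr => u _; rewrite mulrC; congr (_ * expR _); rewrite /c; lra.
Qed.

(** The part of [S] in a large box is compact, hence covered by finitely many half-spaces; the
    outside of the box is covered by those of the signed unit vectors. This builds exponential
    tightness into the cover. *)
Lemma closed_prob_le (S : set 'rV[R]_n) (l : R) : closed S ->
  (forall v, S v -> (l%:E < diag_legendre a v)%E) ->
  exists K : R, forall T A, 0 < T -> measurable A ->
    (forall w, A w -> S (T^-1 *: X T w)) -> (P A <= (K * expR (- (T * l)))%:E)%E.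
Proof.
(* If |v_i| > L, then |v_i| - a_i / 2 > |l| >= l, so a signed unit vector separates v at level l. *)
move=> cS Sl; pose L := `|l| + (\sum_i a i) / 2.
have cK : compact [set v : 'rV[R]_n | forall i, `[- L, L]%classic (v ord0 i)].
  by apply: (@rV_compact _ _ (fun=> `[- L, L]%classic)) => _; exact: segment_compact.
have := compact_closedI cK cS; rewrite compact_cover.
move=> /(_ _ [set: 'rV[R]_n] (fun u => [set v | l < rv_dot u v - diag_form a u])).
case.
- move=> u _.
  have -> : [set v | l < rv_dot u v - diag_form a u] =
      rv_dot u @^-1` [set x | l + diag_form a u < x].
    by apply/seteqP; split => v /=; rewrite ltrBrDr.
  by apply: open_comp => [v _|]; [exact: continuous_rv_dot|exact: open_gt].
- by move=> v [_ /Sl/lt_diag_legendre[u lu]]; exists u.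
move=> D _ DS.
pose s : seq 'rV[R]_n := finmap.enum_fset D ++
  [seq (-1) ^+ b.1 *: delta_mx 0 b.2 | b : bool * 'I_n <- enum {: bool * 'I_n}].
apply: (half_space_cover_prob (s := s)) => v Sv.
have [vL|] := pselect (forall i, `[- L, L]%classic (v ord0 i)).
  have [u /= uD lu] := DS v (conj vL Sv); exists u; last exact: ltW.
  by rewrite mem_cat uD.
move=> /existsNP[i +]; rewrite /= in_itv/= => /negP.
rewrite negb_and -!ltNge => vL.
(* The boolean exponent gives the unit vector the sign of the coordinate that leaves the box. *)
exists ((-1) ^+ (v ord0 i < - L)%R *: delta_mx 0 i).
  rewrite mem_cat; apply/orP; right; apply/mapP.
  by exists ((v ord0 i < - L)%R, i); rewrite ?mem_enum.
have ai : a i <= \sum_i a i by rewrite (bigD1 i)//= lerDl sumr_ge0.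
rewrite diag_form_delta rv_dotZl rv_dot_delta sqrr_sign.
have := ler_norm l; case: (ltP (v ord0 i) (- L)) vL => /= h1 h2 ll.
  by rewrite expr1 /L in h1 *; lra.
by rewrite expr0 /L in h2 *; lra.
Qed.

Lemma near_expRN_le (k y : R) : 0 < k -> 0 < y ->
  \forall T \near +oo%R, expR (- (T * k)) <= y.
Proof.
move=> k0 y0; near=> T; rewrite -[leRHS]lnK ?posrE// ler_expR.
rewrite lerNl -ler_pdivrMr//; near: T; exact: nbhs_pinfty_ge (num_real _).
Unshelve. all: by end_near. Qed.

(* The box of radius [dl] around [v] lies in [S]. Outside the corresponding
   scaled box, [exp (u . X_T)] is at most the sum over the [2 n] faces [b] of the
   exponentials with parameter [U b], whose integrals are smaller by
   [exp (- T k)]. *)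
Lemma open_prob_ge (S : set 'rV[R]_n) v (j e : R) : open S -> S v ->
  diag_legendre a v = j%:E -> 0 < e ->
  \forall T \near +oo%R, forall A, measurable A ->
    (forall w, S (T^-1 *: X T w) -> A w) ->
    ((expR (- (T * (j + e))))%:E <= P A)%E.
Proof.
move=> oS Sv Jj e0; pose u := dual_rv a v.
have Jy : diag_legendre a v != +oo%E by rewrite Jj.
have uE i : a i * u 0 i = v 0 i by exact: dual_rvE.
have jE : j = rv_dot u v - diag_form a u.
  by have := diag_legendre_dual Jy; rewrite Jj => -[].
have /nbhs_ballP[r /= r0 rS] : nbhs v S by exact: open_nbhs_nbhs.
pose N := \sum_i `|u 0 i|; have N0 : 0 <= N by rewrite sumr_ge0.
(* The first bound keeps the box inside [S]; the second keeps u . x within e / 2 of u . v on the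
   box. The added 1 avoids dividing by zero when u = 0. *)
pose dl := Num.min r (e / 2 / (1 + N)).
have dl0 : 0 < dl by rewrite lt_min r0/= !divr_gt0// ltr_pwDl.
have dlr : dl <= r by rewrite ge_min lexx.
have dlN : N * dl <= e / 2.
  apply: (@le_trans _ _ ((1 + N) * dl)).
    by rewrite ler_wpM2r ?lerDr// ltW.
  by rewrite mulrC -ler_pdivlMr ?ltr_pwDl// ge_min lexx orbT.
pose sg := \sum_i a i; have sg0 : 0 <= sg by rewrite sumr_ge0.
(* So small that [a i * s <= dl] for all i: the quadratic cost of tilting by s then eats at most
   half of the linear gain s dl, which leaves [k]. *)
pose s := dl / (1 + sg); have s0 : 0 < s by rewrite divr_gt0// ltr_pwDl.
pose k := s * dl / 2; have k0 : 0 < k by rewrite divr_gt0// mulr_gt0.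
have ks i : s * dl - a i * s ^+ 2 / 2 >= k.
  have ai : a i * s <= dl.
    apply: (@le_trans _ _ (sg * s)).
      by rewrite ler_pM2r// /sg (bigD1 i)//= lerDl sumr_ge0.
    by rewrite /s mulrCA ler_piMr ?(ltW dl0)// ler_pdivrMr ?ltr_pwDl// mul1r lerDr.
  by rewrite /k; nra.
pose U (b : bool * 'I_n) := u + ((-1) ^+ b.1 * s) *: (delta_mx 0 b.2 : 'rV[R]_n).
have [K hK] := integral_sum_expR_le (enum {: bool * 'I_n}) U.
pose K1 := 1 + \sum_(b <- enum {: bool * 'I_n}) `|K b|.
have K10 : 0 < K1 by rewrite ltr_pwDl// sumr_ge0.
have [C hC] := X_mgf u.
near=> T => A mA SA.
have T0 : 0 < T by near: T; exact: nbhs_pinfty_gt (num_real _).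
(* This shift makes the exponential of face b dominate exp (u . X_T) beyond that face. In its
   integral the term linear in s cancels, because [a i * u 0 i = v 0 i]. *)
pose c (b : bool * 'I_n) := - ((-1) ^+ b.1 * s * T * v 0 b.2) - s * T * dl.
pose B := expR (T * (rv_dot u v + N * dl)).
have B0 : 0 < B by exact: expR_gt0.
have pt w : ((expR (rv_dot u (X T w)))%:E <= (B * \1_A w)%:E +
    \sum_(b <- enum {: bool * 'I_n}) (expR (rv_dot (U b) (X T w) + c b))%:E)%E.
  rewrite sumEFin -EFinD lee_fin.
  have [h|] := pselect (forall i, `|v 0 i - T^-1 * X T w 0 i| < dl).
    have wA : A w.
      apply/SA/rS; split => // i0 i; rewrite ord1 /ball/=.
      by rewrite mxE; exact: lt_le_trans (h i) dlr.
    rewrite indicE mem_set// mulr1 -[leLHS]addr0 lerD//; last first.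
      by apply: sumr_ge0 => b _; exact: expR_ge0.
    rewrite ler_expR -ler_pdivrMl// -rv_dotZr /N mulr_suml -big_split/=.
    have XE i : (T^-1 *: X T w) 0 i = T^-1 * X T w 0 i by rewrite mxE.
    rewrite [leLHS]/rv_dot; apply: ler_sum => i _; rewrite XE.
    have := h i; rewrite ltr_norml => /andP[h1 h2].
    have := ler_norm (u 0 i); have := ler_norm (- u 0 i); rewrite normrN.
    by have := normr_ge0 (u 0 i); nra.
  move=> /existsNP[i /negP]; rewrite -leNgt => h.
  rewrite -[leLHS]add0r lerD//; first by rewrite mulr_ge0// ltW.
  pose b := (v 0 i > T^-1 * X T w 0 i)%R.
  rewrite big_enum/= (bigD1 (b, i))//= -[leLHS]addr0 lerD//; last first.
    by apply: sumr_ge0 => b' _; exact: expR_ge0.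
  rewrite ler_expR rv_dotDl -addrA lerDl rv_dotZl rv_dot_delta /c/=.
  have XE : X T w 0 i = T * (T^-1 * X T w 0 i) by rewrite mulrA divff ?mul1r ?gt_eqF.
  rewrite XE; move: h; rewrite /b; set x := T^-1 * _; case: (ltP x (v 0 i)) => /= xv.
    rewrite gtr0_norm ?subr_gt0// expr1 => h.
    have : 0 <= (s * T) * (v 0 i - x - dl).
      by apply: mulr_ge0; [apply: mulr_ge0; exact: ltW|lra].
    lra.
  rewrite ler0_norm ?subr_le0// expr0 => h.
  have : 0 <= (s * T) * (x - v 0 i - dl).
    by apply: mulr_ge0; [apply: mulr_ge0; exact: ltW|lra].
  lra.
have main : ((expR (T * diag_form a u - C))%:E <= B%:E * P A +
    (expR (T * diag_form a u - T * k) * K1)%:E)%E.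
  have /andP[+ _] := hC _ T0; move=> /le_trans; apply.
  have mc b : measurable_fun [set: Omega] (fun w =>
      (expR (rv_dot (U b) (X T w) + c b))%:E).
    exact: measurable_expR_rv_dot.
  apply: (@le_trans _ _ (\int[P]_w ((B * \1_A w)%:E +
    \sum_(b <- enum {: bool * 'I_n}) (expR (rv_dot (U b) (X T w) + c b))%:E))%E).
    apply: ge0_le_integral => //.
    - by have := measurable_expR_rv_dot u 0 T0; under eq_fun do rewrite addr0.
    - apply: emeasurable_funD; last by apply: emeasurable_sum.
      by apply/measurable_EFinP; apply: measurable_funM.
  rewrite ge0_integralD//; last 4 first.
  - by move=> w _; rewrite lee_fin mulr_ge0// ltW.
  - by apply/measurable_EFinP; apply: measurable_funM.
  - by move=> w _; apply: sume_ge0 => b _; rewrite lee_fin expR_ge0.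
  - by apply: emeasurable_sum.
  apply: leeD.
    under eq_integral do rewrite EFinM.
    rewrite ge0_integralZl//; last by rewrite lee_fin ltW.
      by rewrite integral_indic// setIT.
    exact/measurable_EFinP.
  apply: (le_trans (hK _ _ T0)); rewrite lee_fin /K1 mulrDr mulr1 mulr_sumr.
  rewrite -[leLHS]add0r lerD ?expR_ge0//; apply: ler_sum => b _.
  apply: (@le_trans _ _ (expR (T * diag_form a (U b) + c b) * `|K b|)).
    by rewrite ler_pM2l ?expR_gt0// ler_norm.
  rewrite ler_wpM2r// ler_expR diag_form_addZ uE exprMn sqrr_sign mul1r /c.
  have : 0 <= T * (s * dl - a b.2 * s ^+ 2 / 2 - k).
    by rewrite mulr_ge0 ?(ltW T0)// subr_ge0.
  lra.
have PAfin : P A \is a fin_num by exact: fin_num_measure.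
move: main; rewrite -(fineK PAfin) -EFinM -EFinD !lee_fin.
set p := fine (P A) => main.
(* For large T, one half of exp (- C) absorbs the mass outside the box and the other half exceeds
   exp (- T e / 2). The remaining e / 2 of the margin pays for the width of the box. *)
have small : expR (- (T * k)) * K1 <= expR (- C) / 2.
  rewrite -ler_pdivlMr//; near: T; apply: near_expRN_le => //.
  by rewrite !divr_gt0 ?expR_gt0.
have big : expR (- (T * (e / 2))) <= expR (- C) / 2.
  by near: T; apply: near_expRN_le; rewrite ?divr_gt0 ?expR_gt0.
have p0 : 0 <= p by exact: fine_ge0.
have h1 : expR (T * diag_form a u) * expR (- (T * (e / 2))) <= B * p.
  move: main; rewrite !expRD => main.
  have := expR_ge0 (T * diag_form a u); nra.
rewrite -(@ler_pM2l _ B)//; apply: le_trans h1; rewrite -!expRD ler_expR jE.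
have : 0 <= T * (e / 2 - N * dl) by rewrite mulr_ge0 ?(ltW T0)// subr_ge0.
lra.
Unshelve. all: by end_near. Qed.

End exponential_estimates.

(** * From exponential bounds to logarithmic limits *)

Section ldp_limits.
Context {R : realType}.
Local Open Scope ereal_scope.

(** Used to reduce both limits to real levels, since the infimum of the rate may be +oo. *)
Lemma lee_forall_fin (x y : \bar R) :
  (forall l : R, l%:E < x -> l%:E <= y) -> x <= y.
Proof.
case: x => [r| |] h; last by rewrite leNye.
  apply/lee_addgt0Pr => e e0; rewrite -leeBlDr// -EFinB; apply: h.
  by rewrite lte_fin ltrBlDr ltrDl.
by rewrite (eq_infty (fun r => h r (ltry r))).
Qed.

Lemma limf_esup_near_le (T : choiceType) (X : filteredType T) (F : set_system X)
  (f : X -> \bar R) (b : \bar R) :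
  F [set x | f x <= b] -> limf_esup f F <= b.
Proof.
move=> Fb; rewrite limf_esupE; apply: le_trans (ereal_inf_lbound _) _.
  by exists [set x | f x <= b]; first exact: Fb.
by apply: ge_ereal_sup => _ [x + <-].
Qed.

Lemma limf_einf_near_ge (T : choiceType) (X : filteredType T) (F : set_system X)
  (f : X -> \bar R) (b : \bar R) :
  F [set x | b <= f x] -> b <= limf_einf f F.
Proof.
move=> Fb; rewrite limf_einfE; apply: le_ereal_sup_tmp.
by eexists; [exists [set x | b <= f x] => //|apply: le_ereal_inf_tmp => _ [x + <-]].
Qed.

(** The constant [K] may depend on the level: it contributes ln K / T, which vanishes in the
    limit. *)
Lemma limf_esup_scaled_lne_le (p : R -> \bar R) (m : \bar R) :
  (forall T, 0 <= p T) ->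
  (forall l : R, l%:E < m -> exists K : R, \forall T \near +oo%R,
     p T <= (K * expR (- (T * l)))%:E) ->
  limf_esup (fun T : R => T^-1%:E * lne (p T)) (pinfty_nbhs R) <= - m.
Proof.
move=> p0 hp; rewrite leeNr; apply: lee_forall_fin => l /hp[K hK].
rewrite leeNr; apply/lee_addgt0Pr => e e0; apply: limf_esup_near_le.
(* [K] carries no sign information, and its logarithm is about to be taken. *)
pose K' := (1 + `|K|)%R; have K'0 : (0 < K')%R by rewrite ltr_pwDl.
near=> T; have T0 : (0 < T)%R by near: T; exact: nbhs_pinfty_gt (num_real _).
rewrite /= lee_pdivrMl//.
apply: (@le_trans _ _ (lne (K' * expR (- (T * l)))%:E)).
  rewrite lee_lne ?in_itv/= ?p0 ?leey ?lee_fin ?mulr_ge0 ?expR_ge0 ?(ltW K'0)//.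
  apply: (@le_trans _ _ (K * expR (- (T * l)))%:E); first by near: T.
  rewrite lee_fin ler_pM2r ?expR_gt0// /K'.
  by rewrite (le_trans (ler_norm _))// lerDr.
rewrite lne_EFin ?mulr_gt0 ?expR_gt0// lnM ?posrE ?expR_gt0// expRK.
rewrite -EFinD -EFinM lee_fin.
have : (ln K' <= T * e)%R.
  rewrite -ler_pdivrMr//; near: T; exact: nbhs_pinfty_ge (num_real _).
by lra.
Unshelve. all: by end_near. Qed.

Lemma limf_einf_scaled_lne_ge (p : R -> \bar R) (m : \bar R) :
  (forall T, 0 <= p T) ->
  (forall l : R, m < l%:E -> \forall T \near +oo%R, (expR (- (T * l)))%:E <= p T) ->
  - m <= limf_einf (fun T : R => T^-1%:E * lne (p T)) (pinfty_nbhs R).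
Proof.
move=> p0 hp; apply: lee_forall_fin => l lm; apply: limf_einf_near_ge.
have {}/hp hl : m < (- l)%:E by rewrite EFinN lteNr.
near=> T; have T0 : (0 < T)%R by near: T; exact: nbhs_pinfty_gt (num_real _).
rewrite /= lee_pdivlMl//.
apply: (@le_trans _ _ (lne (expR (- (T * - l)))%:E)).
  by rewrite lne_EFin ?expR_gt0// expRK mulrN opprK.
rewrite lee_lne ?in_itv/= ?p0 ?leey ?lee_fin ?expR_ge0//; by near: T.
Unshelve. all: by end_near. Qed.

End ldp_limits.

(** * The large deviations principle and its transport by a continuous map *)

Section gaussian_ldp.
Context {R : realType} {d : measure_display} {Omega : measurableType d}.
Variables (P : probability Omega R) (n : nat) (a : 'I_n -> R).
Variable X : R -> Omega -> 'rV[R]_n.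
Hypothesis a_ge0 : forall i, 0 <= a i.
Hypothesis mX : forall T, 0 < T -> forall i,
  measurable_fun [set: Omega] (fun w => X T w 0 i).
Hypothesis X_mgf : forall u, exists C : R, forall T, 0 < T ->
  ((expR (T * diag_form a u - C))%:E <=
     \int[P]_w (expR (rv_dot u (X T w)))%:E <=
   (expR (T * diag_form a u + C))%:E)%E.

(** Both bounds pull back along [Phi]. The identity [I (Phi v) = diag_legendre a v] makes the
    Legendre transform constant on fibres, so no infimum over fibres appears. Sublevel sets of [I]
    are images of compact sets, hence compact, and closed as [V] is Hausdorff; this yields lower
    semicontinuity. *)
Theorem contracted_gaussian_ldp (V : topologicalType) (Phi : 'rV[R]_n -> V)
    (I : V -> \bar R) (Z : R -> Omega -> V) :
  hausdorff_space V -> continuous Phi ->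
  (forall v, I (Phi v) = diag_legendre a v) ->
  (forall x, (I x < +oo)%E -> exists v, x = Phi v) ->
  (forall T, 0 < T -> forall w, Z T w = Phi (T^-1 *: X T w)) ->
  (forall T, 0 < T -> forall G, open G -> measurable (Z T @^-1` G)) ->
  satisfies_ldp P Z I /\ good_rate_function I.
Proof.
move=> hV cPhi IPhi Irange ZE mZ.
have I0 x : (0 <= I x)%E.
  have [|] := ltP (I x) +oo%E => [/Irange[v ->]|]; last exact: le_trans (leey _).
  by rewrite IPhi; exact: diag_legendre_ge0.
have subE (l : R) : [set x | (I x <= l%:E)%E] =
    Phi @` [set v | (diag_legendre a v <= l%:E)%E].
  apply/seteqP; split => [x /= xl|_ [v vl <-]]; last by rewrite /= IPhi.
  have [v xv] : exists v, x = Phi v by apply: Irange; rewrite (le_lt_trans xl) ?ltry.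
  by exists v; rewrite // /= -IPhi -xv.
have cpt (l : R) : compact [set x | (I x <= l%:E)%E].
  rewrite subE; apply: continuous_compact.
    by apply: continuous_subspaceT => v; exact: cPhi.
  exact: diag_legendre_sublevel_compact.
have rI : rate_function I.
  split=> //; apply/lower_semicontinuousP => l.
  have -> : [set x | (l%:E < I x)%E] = ~` [set x | (I x <= l%:E)%E].
    by apply/seteqP; split => x /=; rewrite ltNge => /negP.
  by apply: closed_openC; apply: compact_closed.
split; last by split=> // l _; exact: cpt.
have mZc T C : 0 < T -> closed C -> measurable (Z T @^-1` C).
  move=> T0 cC; have := measurableC (mZ T T0 _ (closed_openC cC)).
  by rewrite preimage_setC setCK.
split=> // [G oG|C cC].
  apply: limf_einf_scaled_lne_ge => // l.
  move=> /ereal_inf_lt[_ [x Gx <-] xl].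
  have [v xv] : exists v, x = Phi v by apply: Irange; rewrite (lt_trans xl) ?ltry.
  move: xl; rewrite xv IPhi; have := diag_legendre_ge0 v a_ge0.
  case Jv : (diag_legendre a v) => [j| |]//= _; rewrite lte_fin => jl.
  have oS : open (Phi @^-1` G) by apply: open_comp.
  have Sv : (Phi @^-1` G) v by rewrite /= -xv.
  have lj0 : 0 < l - j by rewrite subr_gt0.
  near=> T; have T0 : (0 < T)%R by near: T; exact: nbhs_pinfty_gt (num_real _).
  have -> : l = j + (l - j) by lra.
  have : forall A, measurable A ->
    (forall w, (Phi @^-1` G) (T^-1 *: X T w) -> A w) ->
    ((expR (- (T * (j + (l - j)))))%:E <= P A)%E.
    by near: T; exact: (open_prob_ge a_ge0 mX X_mgf oS Sv Jv lj0).
  by apply; [exact: mZ|move=> w /=; rewrite ZE].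
apply: limf_esup_scaled_lne_le => // l lI.
have cS : closed (Phi @^-1` C) by apply: preimage_closed.
have [|K hK] := closed_prob_le a_ge0 mX X_mgf cS (l := l).
  by move=> v Cv; rewrite (lt_le_trans lI)// -IPhi; apply: ereal_inf_lbound; exists (Phi v).
exists K; near=> T; have T0 : (0 < T)%R by near: T; exact: nbhs_pinfty_gt (num_real _).
by apply: hK => //; [exact: mZc|move=> w /=; rewrite ZE].
Unshelve. all: by end_near. Qed.

End gaussian_ldp.

(** * Exponential moments of Brownian increments *)

Section change_of_measure.
Context {d1 d2 : measure_display} {T1 : measurableType d1} {T2 : measurableType d2}.
Context {R : realType}.
Variables (mu : {measure set T1 -> \bar R}) (nu : {measure set T2 -> \bar R}).
Variables (Y : T1 -> T2) (G : T1 -> R).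
Hypotheses (mY : measurable_fun [set: T1] Y) (mG : measurable_fun [set: T1] G).
Hypothesis G_ge0 : forall x, 0 <= G x.
Hypothesis nuE : forall B, measurable B ->
  nu B = (\int[mu]_(x in Y @^-1` B) (G x)%:E)%E.
Import HBNNSimple.

Let mYB B : measurable B -> measurable (Y @^-1` B).
Proof. by move=> mB; rewrite -[X in measurable X]setTI; exact: mY. Qed.

(** One formula for three uses: the normal density ([Y] the identity), the law of an increment ([G]
    constantly 1), and the removal of an independent factor [G]. The proof approximates [h] by
    simple functions. *)
Lemma ge0_integral_density (h : T2 -> R) :
  measurable_fun [set: T2] h -> (forall y, 0 <= h y) ->
  (\int[nu]_y (h y)%:E = \int[mu]_x (h (Y x) * G x)%:E)%E.
Proof.
move=> /measurable_EFinP mh h0; pose f_ := nnsfun_approx measurableT mh.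
have fh y : EFin \o f_ ^~ y @ \oo --> (h y)%:E.
  by apply: cvg_nnsfun_approx => // x _; rewrite lee_fin.
transitivity (limn (fun n => \int[nu]_y (f_ n y)%:E)%E).
  rewrite -monotone_convergence//.
  - by apply: eq_integral => y _; apply/esym/cvg_lim => //; exact: fh.
  - by move=> n; exact/measurable_EFinP/measurable_funP.
  - by move=> n y _; rewrite lee_fin.
  - by move=> y _ m n mn; rewrite lee_fin; exact/lefP/nd_nnsfun_approx.
have mfY n : measurable_fun [set: T1] (fun x => f_ n (Y x)).
  by apply: (measurableT_comp (measurable_funP (f_ n))).
transitivity (limn (fun n => \int[mu]_x ((f_ n (Y x))%:E * (G x)%:E))%E); last first.
  rewrite -monotone_convergence//.
  - apply: eq_integral => x _; apply/cvg_lim => //.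
    by rewrite EFinM; apply: cvgeM; [|exact: fh|exact: cvg_cst].
  - move=> n; rewrite /=; apply/measurable_EFinP; exact: measurable_funM.
  - by move=> n x _; rewrite -EFinM lee_fin mulr_ge0.
  - move=> x _ m n mn; rewrite -!EFinM lee_fin ler_wpM2r//.
    exact/lefP/nd_nnsfun_approx.
congr (limn _); apply/funext => n.
have mfn r : measurable (f_ n @^-1` [set r]) by exact: measurable_sfunP.
transitivity (\sum_(k \in range (f_ n))
    \int[mu]_x ((k * \1_(f_ n @^-1` [set k]) (Y x))%:E * (G x)%:E))%E.
  under eq_integral do rewrite fimfunE -fsumEFin//.
  rewrite ge0_integral_fsum//; last 2 first.
  - by move=> r; exact/measurable_EFinP/measurable_funM.
  - by move=> r y _; rewrite nnfun_muleindic_ge0.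
  apply: eq_fsbigr => r; rewrite inE => -[y _ yr].
  have r0 : 0 <= r by rewrite -yr.
  rewrite integralZl_indic_nnsfun// integral_indic// setIT nuE//.
  under [RHS]eq_integral do rewrite EFinM -muleA.
  rewrite ge0_integralZl//=; last 2 first.
  - apply: emeasurable_funM; last exact/measurable_EFinP.
    by apply/measurable_EFinP; apply: measurableT_comp.
  - by move=> x _; rewrite -EFinM lee_fin mulr_ge0.
  congr (_ * _)%E; rewrite integral_mkcond; apply: eq_integral => x _.
  rewrite patchE indicE; case: ifPn => xr.
    by rewrite (_ : Y x \in _)%R ?mul1e// inE; move: xr; rewrite inE.
  rewrite (_ : (Y x \in _) = false) ?mul0e//; apply/negbTE; move: xr; apply: contra.
  by rewrite !inE.
rewrite -ge0_integral_fsum//.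
- apply: eq_integral => x _; rewrite fimfunE -fsumEFin//.
  rewrite !fsbig_finite//= ge0_sume_distrl// => r _.
  exact: nnfun_muleindic_ge0.
- move=> r; rewrite /=; apply/measurable_EFinP; apply: measurable_funM => //.
  by apply: measurable_funM => //; apply: measurableT_comp.
- by move=> r x _; rewrite mule_ge0 ?nnfun_muleindic_ge0// lee_fin.
Qed.

End change_of_measure.

Section independent_factor.
Context {d : measure_display} {Omega : measurableType d} {R : realType}.
Variable P : probability Omega R.

(** The last hypothesis says that the law of [Y] weighted by [G] is c times its law. This is weaker
    than independence of [G] and [Y], and it is what an induction can supply. *)
Lemma integral_mul_indep (G Y : Omega -> R) (h : R -> R) (c : R) :
  measurable_fun [set: Omega] Y -> measurable_fun [set: Omega] G ->
  measurable_fun [set: R] h -> (forall w, 0 <= G w) -> (forall y, 0 <= h y) ->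
  0 <= c ->
  (forall B, measurable B ->
    \int[P]_(w in Y @^-1` B) (G w)%:E = c%:E * P (Y @^-1` B))%E ->
  (\int[P]_w (G w * h (Y w))%:E = c%:E * \int[P]_w (h (Y w))%:E)%E.
Proof.
move=> mY mG mh G0 h0 c0 H.
pose c' := NngNum c0.
have := @ge0_integral_density _ _ _ _ _ P (mscale c' (pushforward P Y)) Y G mY mG G0.
move=> /(_ mY (fun B mB => esym (H B mB)) h mh h0).
rewrite ge0_integral_mscale//; last 2 first.
- exact/measurable_EFinP.
- by move=> y _; rewrite lee_fin.
rewrite ge0_integral_pushforward//; last 2 first.
- exact/measurable_EFinP.
- by move=> y _; rewrite lee_fin.
by move=> ->; apply: eq_integral => w _; rewrite mulrC.
Qed.

(** The members of the filtration are bare families of sets rather than measurable structures, so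
    measurability is spelled out. [sub_measurableP] converts it to and from the standard notion. *)
Definition sub_measurable (F : set (set Omega)) (f : Omega -> R) : Prop :=
  forall A, measurable A -> F (f @^-1` A).

Lemma sub_measurableP (F : set (set Omega)) f : sigma_algebra [set: Omega] F ->
  sub_measurable F f <->
  measurable_fun [set: g_sigma_algebraType F] (f : g_sigma_algebraType F -> R).
Proof.
move=> sF; have E := sigma_algebra_id sF.
split=> [h _ A mA|h A mA].
  by rewrite setTI; apply: sub_sigma_algebra; exact: h.
have := h measurableT A mA; rewrite setTI.
by rewrite /measurable/= [X in X _]E.
Qed.

Lemma sub_measurable_sum (F : set (set Omega)) (I : Type) (s : seq I)
    (f : I -> Omega -> R) : sigma_algebra [set: Omega] F ->
  (forall i, sub_measurable F (f i)) ->
  sub_measurable F (fun w => \sum_(i <- s) f i w).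
Proof.
move=> sF mf; apply/sub_measurableP => //.
apply: (@measurable_sum _ (g_sigma_algebraType F)) => i.
by apply/sub_measurableP.
Qed.

Lemma sub_measurableB (F : set (set Omega)) (f g : Omega -> R) :
  sigma_algebra [set: Omega] F ->
  sub_measurable F f -> sub_measurable F g ->
  sub_measurable F (fun w => f w - g w).
Proof.
move=> sF /sub_measurableP mf /sub_measurableP mg; apply/sub_measurableP => //.
by apply: (@measurable_funB _ (g_sigma_algebraType F)); [exact: mf|exact: mg].
Qed.

Lemma sub_measurableZ (F : set (set Omega)) (c : R) (f : Omega -> R) :
  sigma_algebra [set: Omega] F ->
  sub_measurable F f -> sub_measurable F (fun w => c * f w).
Proof.
move=> sF /sub_measurableP mf; apply/sub_measurableP => //.
by apply: (@measurable_funM _ (g_sigma_algebraType F)) => //; exact: mf.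
Qed.

Lemma sub_measurableW (F : set (set Omega)) (f : Omega -> R) :
  F `<=` measurable -> sub_measurable F f -> measurable_fun [set: Omega] f.
Proof. by move=> FM mf _ A mA; rewrite setTI; apply/FM/mf. Qed.

End independent_factor.

Section normal_mgf.
Context {R : realType}.

(** Completing the square turns exp (a x) times the centred density into exp (a^2 s^2 / 2) times the
    density with mean a s^2. *)
Lemma integral_expR_normal_prob (a s : R) : s != 0 ->
  (\int[normal_prob 0 s]_x (expR (a * x))%:E = (expR (a ^+ 2 * s ^+ 2 / 2))%:E)%E.
Proof.
move=> s0.
rewrite (@ge0_integral_density _ _ _ _ _ lebesgue_measure (normal_prob 0 s) id
  (normal_pdf 0 s)) //=; last 3 first.
- exact: measurable_normal_pdf.
- by move=> x; exact: normal_pdf_ge0.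
- by apply: measurableT_comp => //; exact: measurable_funM.
transitivity (\int[lebesgue_measure]_x
    ((expR (a ^+ 2 * s ^+ 2 / 2))%:E * (normal_pdf (a * s ^+ 2) s x)%:E))%E.
  apply: eq_integral => x _; rewrite -!EFinM /normal_pdf (negbTE s0).
  congr EFin; rewrite mulrCA [RHS]mulrCA; congr (_ * _).
  rewrite /normal_fun -!expRD; congr expR; rewrite -mulr_natr; field.
  exact: s0.
rewrite ge0_integralZl//; last 2 first.
- apply/measurable_EFinP; exact: measurable_normal_pdf.
- by move=> x _; rewrite lee_fin normal_pdf_ge0.
by rewrite integral_normal_pdf mule1.
Qed.

End normal_mgf.

(** * Passing to the limit in exponential moments *)

Section integral_limit.
Context {d : measure_display} {Omega : measurableType d} {R : realType}.
Variable P : probability Omega R.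

(* The second moments make the sequence uniformly integrable:
   [y <= min y k + y ^ 2 / k]. *)
Lemma cvg_integral_bounded_sqr (f_ : nat -> Omega -> R) (f : Omega -> R) (a K : R) :
  (forall n, measurable_fun [set: Omega] (f_ n)) ->
  measurable_fun [set: Omega] f ->
  (forall n w, 0 <= f_ n w) -> (forall w, 0 <= f w) ->
  (\forall w \ae P, f_ ^~ w @ \oo --> f w) ->
  (fun n => \int[P]_w (f_ n w)%:E)%E @ \oo --> a%:E ->
  (\forall n \near \oo, \int[P]_w (f_ n w ^+ 2)%:E <= K%:E)%E ->
  (\int[P]_w (f w)%:E = a%:E)%E.
Proof.
move=> mf_ mf f_0 f0 f_f fa fK.
have mEf_ n : measurable_fun [set: Omega] (EFin \o f_ n) by exact/measurable_EFinP.
have mEf : measurable_fun [set: Omega] (EFin \o f) by exact/measurable_EFinP.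
have mm k : measurable_fun [set: Omega] (fun w => Num.min (f w) k).
  exact: measurable_minr.
have mm_ k n : measurable_fun [set: Omega] (fun w => Num.min (f_ n w) k).
  exact: measurable_minr.
have min_cvg (k : R) : 0 <= k -> (fun n => \int[P]_w (Num.min (f_ n w) k)%:E)%E @ \oo -->
    (\int[P]_w (Num.min (f w) k)%:E)%E.
  move=> k0.
  have [|//|//|//|//|_ _ ] := @dominated_convergence _ _ _ P _ measurableT
    (fun n w => (Num.min (f_ n w) k)%:E) (fun w => (Num.min (f w) k)%:E) (cst k%:E).
  - by move=> n; apply/measurable_EFinP.
  - by apply/measurable_EFinP.
  - apply: filterS f_f => w fw _; apply: cvg_EFin; first exact: nearW.
    apply: (@cvg_comp _ _ _ _ (fun y : R => Num.min y k) _ _ _ fw).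
    apply: (@continuous_min _ _ (id : R -> R^o) (cst k)); [exact: cvg_id|exact: cvg_cst].
  - exact: finite_measure_integrable_cst.
  - apply: aeW => w n _; rewrite gee0_abs lee_fin ?le_min ?f_0//.
    by rewrite ge_min lexx orbT.
  by [].
(* The upper bound on the integral of f needs only truncation and monotone convergence; the second
   moments serve for the reverse bound. *)
apply/eqP; rewrite eq_le; apply/andP; split.
  have := @cvg_monotone_convergence _ _ _ P _ measurableT
    (fun k w => (Num.min (f w) k%:R)%:E).
  have mk k : measurable_fun [set: Omega] (fun w => (Num.min (f w) k%:R)%:E).
    exact/measurable_EFinP.
  have k0 k w : [set: Omega] w -> (0 <= (Num.min (f w) k%:R)%:E)%E.
    by move=> _; rewrite lee_fin le_min f0/=.
  have nd w : [set: Omega] w ->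
      {homo (fun k => (Num.min (f w) k%:R)%:E) : m n / (m <= n)%N >-> (m <= n)%E}.
    move=> _ m n mn; rewrite lee_fin le_min !ge_min lexx/=.
    by rewrite ler_nat mn orbT.
  move=> /(_ mk k0 nd).
  under eq_integral => w _.
    rewrite (_ : limn _ = (f w)%:E); last first.
      apply/cvg_lim => //; apply: cvg_near_cst; near=> k; congr EFin.
      apply/min_idPl; near: k; exact: nbhs_infty_ger.
    over.
  move=> cf; apply: (cvge_le (b := a%:E) _ cf); near=> k.
  apply: (lee_cvg_to (min_cvg k%:R _) fa) => //; near=> n.
  apply: ge0_le_integral => //.
  - by move=> w _; rewrite lee_fin le_min f_0/=.
  - exact/measurable_EFinP.
  - exact/measurable_EFinP.
  - by move=> w _; rewrite lee_fin ge_min lexx.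
have K0 : 0 <= K.
  have : exists n, (\int[P]_w (f_ n w ^+ 2)%:E <= K%:E)%E by exact: filter_ex fK.
  move=> [n]; rewrite -lee_fin; apply: le_trans; apply: integral_ge0 => w _.
  by rewrite lee_fin sqr_ge0.
apply/lee_addgt0Pr => e e0.
(* Chosen so that the tail term K / k is at most e. *)
pose k := (K + 1) / e; have k0 : 0 < k by rewrite divr_gt0// ltr_wpDl.
apply: (@le_trans _ _ (\int[P]_w (Num.min (f w) k)%:E + e%:E)%E); last first.
  rewrite leeD2r//; apply: ge0_le_integral => //.
  - by move=> w _; rewrite lee_fin le_min f0 ltW.
  - exact/measurable_EFinP.
  - by move=> w _; rewrite lee_fin ge_min lexx.
have cgs : (fun n => \int[P]_w (Num.min (f_ n w) k)%:E + e%:E)%E @ \oo -->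
    (\int[P]_w (Num.min (f w) k)%:E + e%:E)%E.
  apply: cvgeD; [|exact: (min_cvg _ (ltW k0))|exact: cvg_cst].
  exact: fin_num_adde_defl.
apply: (lee_cvg_to fa cgs); near=> n.
apply: (@le_trans _ _ (\int[P]_w ((Num.min (f_ n w) k)%:E + (k^-1 * f_ n w ^+ 2)%:E))%E).
  apply: ge0_le_integral => //.
  - by move=> w _; rewrite lee_fin.
  - exact/measurable_EFinP.
  - apply/measurable_EFinP; apply: measurable_funD => //; apply: measurable_funM => //.
    exact: measurable_funX.
  - move=> w _; rewrite -EFinD lee_fin; case: (leP (f_ n w) k) => fk.
      by rewrite lerDl mulr_ge0 ?sqr_ge0// invr_ge0 ltW.
    rewrite -lerBlDl mulrC ler_pdivlMr//; have := f_0 n w; nra.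
rewrite ge0_integralD//; last 4 first.
- by move=> w _; rewrite lee_fin le_min f_0 ltW.
- exact/measurable_EFinP.
- by move=> w _; rewrite lee_fin mulr_ge0 ?sqr_ge0// invr_ge0 ltW.
- apply/measurable_EFinP; apply: measurable_funM => //; exact: measurable_funX.
rewrite leeD2l//; under eq_integral do rewrite EFinM.
rewrite ge0_integralZl//; last 3 first.
- by apply/measurable_EFinP; exact: measurable_funX.
- by move=> w _; rewrite lee_fin sqr_ge0.
- by rewrite lee_fin invr_ge0 ltW.
apply: (@le_trans _ _ (k^-1%:E * K%:E)%E).
  by rewrite lee_pmul2l ?lte_fin ?invr_gt0//; near: n.
rewrite -EFinM lee_fin /k invf_div mulrAC ler_pdivrMr ?ltr_wpDl//; nra.
Unshelve. all: by end_near. Qed.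

End integral_limit.

(** * Weighted sums of increments of one Brownian motion *)

Section brownian_increments.
Context {d : measure_display} {Omega : measurableType d} {R : realType}.
Variables (P : probability Omega R) (F : R -> set (set Omega)).
Hypothesis filtF : filtration F.

Lemma filtration_sigma t : 0 <= t -> sigma_algebra [set: Omega] (F t).
Proof. by move=> t0; have [/(_ t t0)[]] := filtF. Qed.

Lemma filtration_measurable t : 0 <= t -> F t `<=` measurable.
Proof. by move=> t0; have [/(_ t t0)[]] := filtF. Qed.

Lemma sub_measurable_le s t (f : Omega -> R) : 0 <= s -> s <= t ->
  sub_measurable (F s) f -> sub_measurable (F t) f.
Proof. by move=> s0 st mf A mA; have [_ /(_ s t s0 st)] := filtF; apply; exact: mf. Qed.

Definition increments_sum (B : R -> Omega -> R) (c t : nat -> R) n (w : Omega) : R :=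
  \sum_(j < n) c j * (B (t j.+1) w - B (t j) w).

Variable B : R -> Omega -> R.
Hypothesis bmB : brownian_motion P F B.

Lemma sub_measurable_brownian t : 0 <= t -> sub_measurable (F t) (B t).
Proof. by move=> t0; have [/(_ t t0)] := bmB. Qed.

Lemma measurable_brownian t : 0 <= t -> measurable_fun [set: Omega] (B t).
Proof.
move=> t0; apply: sub_measurableW (sub_measurable_brownian t0).
exact: filtration_measurable.
Qed.

Lemma integral_expR_increment (a s t : R) : 0 <= s -> s < t ->
  (\int[P]_w (expR (a * (B t w - B s w)))%:E = (expR (a ^+ 2 * (t - s) / 2))%:E)%E.
Proof.
move=> s0 st; have t0 : 0 <= t by rewrite (le_trans s0)// ltW.
have mD : measurable_fun [set: Omega] (fun w => B t w - B s w).
  by apply: measurable_funB; exact: measurable_brownian.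
have mE : measurable_fun [set: R] (fun x => expR (a * x)).
  by apply: measurableT_comp => //; exact: measurable_funM.
have ts : Num.sqrt (t - s) != 0 by rewrite gt_eqF// sqrtr_gt0 subr_gt0.
have := integral_expR_normal_prob a ts.
rewrite sqr_sqrtr ?subr_ge0 ?ltW// => <-.
rewrite (@ge0_integral_density _ _ _ _ _ P (normal_prob 0 (Num.sqrt (t - s)))
  (fun w => B t w - B s w) (cst 1) mD _ _ _ (fun x => expR (a * x)))//.
- by apply: eq_integral => w _; rewrite mulr1.
- move=> A mA; rewrite (integral_cst P _ 1) ?mul1e//.
    by have [_ _ _ h _] := bmB; exact/esym/(h s t s0 st A mA).
  by rewrite -[X in measurable X]setTI; exact: mD.
Qed.

Lemma increments_sum_adapted (c t : nat -> R) n : 0 <= t 0%N ->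
  (forall j, t j < t j.+1) -> sub_measurable (F (t n)) (increments_sum B c t n).
Proof.
move=> t0 ti; have mono i j : (i <= j)%N -> t i <= t j.
  elim: j => [|j IH]; first by rewrite leqn0 => /eqP ->.
  by rewrite leq_eqVlt => /predU1P[->//|/IH]; move/le_trans; apply; exact: ltW.
have tp j : 0 <= t j by rewrite (le_trans t0)// mono.
have sF := filtration_sigma (tp n).
apply: sub_measurable_sum => //= j; apply: sub_measurableZ => //.
apply: sub_measurableB => //.
- by apply: sub_measurable_le (sub_measurable_brownian (tp _)) => //; exact: mono.
- apply: sub_measurable_le (sub_measurable_brownian (tp _)) => //.
  by apply: mono; exact: ltnW.
Qed.

(** Induction on n: the earlier part of the sum is measurable at time t_n, hence independent of the
    last increment, whose exponential moment factors out. *)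
Lemma integral_expR_increments_sum (c t : nat -> R) n : 0 <= t 0%N ->
  (forall j, t j < t j.+1) ->
  (\int[P]_w (expR (increments_sum B c t n w))%:E =
   (expR ((\sum_(j < n) c j ^+ 2 * (t j.+1 - t j)) / 2))%:E)%E.
Proof.
move=> t0 ti; have tp j : 0 <= t j.
  by elim: j => // j /le_trans; apply; exact: ltW.
elim: n => [|n IH].
  rewrite big_ord0 mul0r expR0 -(@probability_setT _ _ _ P).
  under eq_integral do rewrite /increments_sum big_ord0 expR0.
  by rewrite integral_cst// mul1e.
have sF := filtration_sigma (tp n); have FM := filtration_measurable (tp n).
pose D w := B (t n.+1) w - B (t n) w.
have mD : measurable_fun [set: Omega] D.
  by apply: measurable_funB; exact: measurable_brownian.
have mS := increments_sum_adapted c n t0 ti.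
have mE a : measurable_fun [set: R] (fun x => expR (a * x)).
  by apply: measurableT_comp => //; exact: measurable_funM.
pose v := c n ^+ 2 * (t n.+1 - t n) / 2.
have Dv : (\int[P]_w (expR (c n * D w))%:E = (expR v)%:E)%E.
  exact: integral_expR_increment.
(* The definition of Brownian motion gives independence of events only. [integral_mul_indep] is
   applied twice: here to pass to the exponential of the increment, and below to pass to that of the
   earlier sum. *)
have indep E : F (t n) E ->
    (\int[P]_(w in E) (expR (c n * D w))%:E = (expR v)%:E * P E)%E.
  move=> FE; have mE' : measurable E by exact: FM.
  rewrite integral_mkcond.
  transitivity (\int[P]_w (\1_E w * expR (c n * D w))%:E)%E.
    apply: eq_integral => w _; rewrite patchE indicE.
    by case: ifP => _; rewrite ?mul1r ?mul0r.
  rewrite (@integral_mul_indep _ _ _ P (\1_E) D (fun x => expR (c n * x)) (fine (P E)))//.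
  - by rewrite Dv fineK ?fin_num_measure// muleC.
  - exact: fine_ge0.
  - move=> A mA; have mDA : measurable (D @^-1` A).
      by rewrite -[X in measurable X]setTI; exact: mD.
    rewrite integral_indic// fineK ?fin_num_measure//.
    have [_ _ _ _ /(_ (t n) (t n.+1) (tp n) (ti n) A E mA FE)] := bmB.
    by rewrite setIC muleC.
transitivity (\int[P]_w (expR (c n * D w) * expR (increments_sum B c t n w))%:E)%E.
  apply: eq_integral => w _; rewrite -expRD /increments_sum big_ord_recr/=.
  by rewrite addrC.
rewrite (@integral_mul_indep _ _ _ P (fun w => expR (c n * D w))
   (increments_sum B c t n) expR (expR v))//.
- by rewrite IH -EFinM -expRD big_ord_recr/= mulrDl addrC.
- exact: sub_measurableW mS.
- by apply: measurableT_comp => //; exact: measurable_funM.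
- by move=> A mA; rewrite indep//; exact: mS.
Qed.

(** Independence across modes is stated for the sigma-algebras of the single processes; adaptedness
    to the common filtration would not give it. *)
Lemma increments_sum_process_sigma (c t : nat -> R) n :
  (forall j, 0 <= t j) -> sub_measurable (process_sigma B) (increments_sum B c t n).
Proof.
move=> tp; have sF : sigma_algebra [set: Omega] (process_sigma B).
  exact: smallest_sigma_algebra.
have mB s : 0 <= s -> sub_measurable (process_sigma B) (B s).
  by move=> s0 A mA; apply: sub_sigma_algebra; exists s, A.
apply: sub_measurable_sum => //= j; apply: sub_measurableZ => //.
by apply: sub_measurableB => //; exact: mB.
Qed.

End brownian_increments.

(** * Products of exponentials over independent processes *)

Section independent_processes_product.
Context {d : measure_display} {Omega : measurableType d} {R : realType}.
Variables (P : probability Omega R) (B : nat -> R -> Omega -> R).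
Hypothesis indB : independent_processes P B.

(* The indicators of the independence hypothesis are replaced one by one with
   exponentials. *)
Lemma integral_prod_expR_indep n (Y : nat -> Omega -> R) (m : nat -> R) :
  (forall k, (0 < k)%N -> measurable_fun [set: Omega] (Y k)) ->
  (forall k, (0 < k)%N -> sub_measurable (process_sigma (B k)) (Y k)) ->
  (forall k, 0 <= m k) ->
  (forall k, (0 < k)%N -> \int[P]_w (expR (Y k w))%:E = (m k)%:E)%E ->
  (forall k, (0 < k)%N -> process_sigma (B k) `<=` measurable) ->
  (\int[P]_w (expR (\sum_(i < n) Y i.+1 w))%:E = (\prod_(i < n) m i.+1)%:E)%E.
Proof.
move=> mY YB m0 mE BM.
(* A hybrid product: exponentials for the first j factors, indicators for the others. Factor k
   belongs to process k + 1, as processes are numbered from 1. *)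
pose f j (X : nat -> set Omega) k w := if (k < j)%N then expR (Y k.+1 w) else \1_(X k.+1) w.
pose q j (X : nat -> set Omega) k := if (k < j)%N then m k.+1 else fine (P (X k.+1)).
have f0 j X k w : 0 <= f j X k w by rewrite /f; case: ifP; rewrite ?expR_ge0.
have q0 j X k : 0 <= q j X k by rewrite /q; case: ifP => // _; exact: fine_ge0.
have main j X : (forall k, (0 < k)%N -> process_sigma (B k) (X k)) ->
    (\int[P]_w (\prod_(i < n) f j X i w)%:E = (\prod_(i < n) q j X i)%:E)%E.
  elim: j X => [|j IH] X hX.
    have := indB (n := n) (X := X).
    rewrite big_add1 big_mkord /= => h.
    transitivity (P (\bigcap_(k in [set k | (1 <= k <= n)%N]) X k)); last first.
      rewrite h => [|k /andP[k0 _]]; last exact: hX.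
      rewrite -prodEFin; apply: eq_bigr => i _; rewrite /q /= fineK// fin_num_measure//.
      by apply: (BM i.+1) => //; exact: hX.
    have mcap : measurable (\bigcap_(k in [set k | (1 <= k <= n)%N]) X k).
      rewrite -[X in measurable X]setCK setC_bigcap; apply: measurableC.
      apply: bigcup_measurable => k /andP[k0 _].
      by apply: measurableC; apply: (BM k k0); exact: hX.
    rewrite -[X in _ = P X]setIT -integral_indic//.
    set C := \bigcap_(_ in _) _; apply: eq_integral => w _; congr EFin.
    rewrite [RHS]indicE; have [wX|wX] := boolP (w \in C).
      apply: big1 => i _; rewrite /f/= indicE mem_set//.
      by move: wX; rewrite inE; apply; rewrite /= ltn_ord.
    apply/esym; have [k /andP[k0 kn] Xk] : exists2 k, (0 < k <= n)%N & ~ X k w.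
      apply: contrapT => h'; case/negP: wX; rewrite inE => k /= k1.
      by apply: contrapT => Xk; apply: h'; exists k.
    have kn' : (k.-1 < n)%N by rewrite prednK.
    rewrite (bigD1 (Ordinal kn'))//= {1}/f/= prednK// indicE memNset// mul0r//.
  have [nj|jn] := leqP n j.
    have E (g : bool -> nat -> R) : \prod_(i < n) g (i < j.+1)%N i = \prod_(i < n) g (i < j)%N i.
      apply: eq_bigr => i _; have ij : (i < j)%N by exact: leq_trans (ltn_ord i) nj.
      by rewrite ij ltnS ltnW.
    rewrite (E (fun b k => if b then m k.+1 else fine (P (X k.+1)))) -IH//.
    apply: eq_integral => w _; congr EFin.
    by rewrite (E (fun b k => if b then expR (Y k.+1 w) else \1_(X k.+1) w)).
  pose o := Ordinal jn.
  pose G w := \prod_(i < n | i != o) f j X i w.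
  pose c := \prod_(i < n | i != o) q j X i.
  have GE X' w : (forall k, k != j.+1 -> X' k = X k) ->
      \prod_(i < n) f j X' i w = \1_(X' j.+1) w * G w.
    move=> XX; rewrite (bigD1 o)//= /f/= ltnn; congr (_ * _); apply: eq_bigr => i io.
    by rewrite /f /q; case: ifP => // _; rewrite XX// eqSS; move: io; rewrite -val_eqE.
  have cE X' : (forall k, k != j.+1 -> X' k = X k) ->
      \prod_(i < n) q j X' i = fine (P (X' j.+1)) * c.
    move=> XX; rewrite (bigD1 o)//= /q/= ltnn; congr (_ * _); apply: eq_bigr => i io.
    by rewrite /f /q; case: ifP => // _; rewrite XX// eqSS; move: io; rewrite -val_eqE.
  have mG : measurable_fun [set: Omega] G.
    rewrite /G; under eq_fun do rewrite big_mkcond/=.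
    apply: measurable_prod => i _; case: (i != o) => //; rewrite /f.
    case: (i < j)%N; first by apply: measurableT_comp => //; exact: mY.
    by apply: measurable_indic; apply: (BM i.+1) => //; exact: hX.
  have G0 w : 0 <= G w by exact: prodr_ge0.
  have c0 : 0 <= c by exact: prodr_ge0.
  have indep E : process_sigma (B j.+1) E ->
      (\int[P]_(w in E) (G w)%:E = c%:E * P E)%E.
    move=> FE; have mE' : measurable E by exact: (BM j.+1).
    (* The induction hypothesis holds for all events, so the event of process j + 1 may be any [E]:
       the other factors are then uncorrelated with that process, and its indicator can be exchanged
       for an exponential. *)
    pose X' k := if k == j.+1 then E else X k.
    have XX k : k != j.+1 -> X' k = X k by rewrite /X' => /negbTE ->.
    have X'E : X' j.+1 = E by rewrite /X' eqxx.
    have := IH X'; rewrite cE// X'E => /(_ _)/esym h.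
    rewrite muleC -(fineK (fin_num_measure P _ mE')) -EFinM h; last first.
      by move=> k k0; rewrite /X'; case: eqP => [->//|_]; exact: hX.
    rewrite integral_mkcond; apply: eq_integral => w _.
    rewrite GE// X'E patchE indicE.
    by case: ifP => _; rewrite ?mul1r ?mul0r.
  transitivity (\int[P]_w (G w * expR (Y j.+1 w))%:E)%E.
    apply: eq_integral => w _; congr EFin.
    rewrite (bigD1 o)//= mulrC {2}/f ltnS leqnn; congr (_ * _).
    apply: eq_bigr => i io; rewrite /f ltnS leq_eqVlt.
    by rewrite (_ : (i == j :> nat) = false)//; apply/negbTE; move: io; rewrite -val_eqE.
  rewrite (@integral_mul_indep _ _ _ P G (Y j.+1) expR c)//.
  - rewrite mE// -EFinM; congr EFin; rewrite [RHS](bigD1 o)//= mulrC {1}/q ltnS leqnn.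
    congr (_ * _); apply: eq_bigr => i io; rewrite /q ltnS [(i < j)%N]ltn_neqAle.
    by rewrite (_ : (i != j :> nat)); last by move: io; rewrite -val_eqE.
  - exact: mY.
  - by move=> A mA; rewrite indep//; exact: YB.
have := main n (fun=> setT).
rewrite (_ : \prod_(i < n) q _ _ _ = \prod_(i < n) m i.+1); last first.
  by apply: eq_bigr => i _; rewrite /q ltn_ord.
move=> <-; last first.
  move=> k k0; have [_ ] : sigma_algebra [set: Omega] (process_sigma (B k)).
    exact: smallest_sigma_algebra.
  by move=> h _; rewrite -(setD0 setT); apply: h; exact: sigma_algebra0.
apply: eq_integral => w _; congr EFin; rewrite expR_sum; apply: eq_bigr => i _.
by rewrite /f ltn_ord.
Qed.

End independent_processes_product.

(** * Harmonic oscillators driven by a continuous path *)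

Section riemann_sums.
Context {R : realType}.

Lemma uniform_continuity_segment (f : R -> R) (a b e : R) :
  {within `[a, b], continuous f} -> 0 < e ->
  exists2 dl : R, 0 < dl & forall x y, x \in `[a, b] -> y \in `[a, b] ->
    `|x - y| < dl -> `|f x - f y| < e.
Proof.
move=> /subspace_continuousP cf e0.
have := (near_covering_withinP `[a, b]%classic).2
  ((compact_near_coveringP _).1 (@segment_compact _ a b)).
move=> /(_ R (0^'+) (fun dl x => forall y, y \in `[a, b] -> `|x - y| < dl -> `|f x - f y| < e)).
case=> [x xab|].
  have e2 : 0 < e / 2 by rewrite divr_gt0.
  have /cvgrPdist_lt/(_ _ e2) := cf x xab.
  rewrite /= near_withinE => /nbhs_ballP[r /= r0 hr].
  have r2 : 0 < r / 2 by rewrite divr_gt0.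
  exists (ball x (r / 2), [set dl | dl < r / 2]).
    split; first exact: nbhsx_ballx.
    exact: nbhs_right_lt.
  move=> [x' dl] [/= xx' dlr] x'ab y yab x'y.
  have xx'' : `|f x - f x'| < e / 2.
    apply: hr => //; apply: le_ball xx'.
    by rewrite ler_pdivrMr// mulr_natr mulr2n lerDl ltW.
  have xy : `|f x - f y| < e / 2.
    apply: hr => //; rewrite /ball/= -[x](subrK x') -addrA.
    rewrite (le_lt_trans (ler_normD _ _))// [r]splitr ltrD//.
    exact: lt_trans x'y dlr.
  rewrite -[f x'](subrK (f x)) -addrA (le_lt_trans (ler_normD _ _))//.
  by rewrite [e]splitr ltrD// distrC.
move=> dl0 /= dl0p KV; have dlp : 0 < dl0 / 2 by rewrite divr_gt0.
exists (dl0 / 2) => // x y xab yab xy.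
apply: (KV (dl0 / 2) _ dlp x xab y yab xy).
rewrite /= sub0r normrN gtr0_norm// ltr_pdivrMr// mulr_natr mulr2n.
by rewrite ltrDl.
Qed.

Definition grid (T : R) (n j : nat) : R := T * j%:R / n.+1%:R.

Lemma grid0 T n : grid T n 0 = 0.
Proof. by rewrite /grid mulr0 mul0r. Qed.

Lemma grid_last T n : grid T n n.+1 = T.
Proof. by rewrite /grid mulfK// pnatr_eq0. Qed.

Lemma gridS T n j : grid T n j.+1 - grid T n j = T / n.+1%:R.
Proof. by rewrite /grid -mulrBl -mulrBr -natrB// subSnn mulr1. Qed.

Lemma grid_lt T n j : 0 < T -> grid T n j < grid T n j.+1.
Proof. by move=> T0; rewrite -subr_gt0 gridS divr_gt0. Qed.

Lemma grid_in T n j : 0 < T -> (j <= n.+1)%N -> grid T n j \in `[0, T].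
Proof.
move=> T0 jn; rewrite in_itv/= /grid; apply/andP; split.
  by rewrite divr_ge0// mulr_ge0// ltW.
by rewrite ler_pdivrMr// ler_pM2l// ler_nat.
Qed.

(* [H] plays the role of the primitive of [f * g], so that no integral occurs. *)
Lemma cvg_riemann_stieltjes (f g G H : R -> R) (T C : R) (tau : nat -> nat -> R) :
  0 < T -> {within `[0, T], continuous f} ->
  {within `[0, T], continuous G} -> {within `[0, T], continuous H} ->
  (forall x, x \in `]0, T[ -> is_derive x 1 G (g x)) ->
  (forall x, x \in `]0, T[ -> is_derive x 1 H (f x * g x)) ->
  (forall x, x \in `[0, T] -> `|g x| <= C) ->
  (forall n j, (j <= n)%N -> grid T n j <= tau n j <= grid T n j.+1) ->
  (fun n => \sum_(j < n.+1) f (tau n j) * (G (grid T n j.+1) - G (grid T n j)))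
    @ \oo --> H T - H 0.
Proof.
move=> T0 cf cG cH dG dH gC htau.
have C0 : 0 <= C by apply: le_trans (normr_ge0 _) (gC 0 _); rewrite in_itv/= lexx ltW.
apply/cvgrPdist_le => e e0.
pose e' := e / (T * (C + 1)).
have e'0 : 0 < e' by rewrite divr_gt0// mulr_gt0// ltr_wpDl.
have [dl dl0 fdl] := uniform_continuity_segment cf e'0.
near=> n.
have Tn : T / n.+1%:R < dl.
  rewrite ltr_pdivrMr// mulrC -ltr_pdivrMr//.
  have : T / dl < n%:R by near: n; exact: nbhs_infty_gtr.
  by move/lt_trans; apply; rewrite ltr_nat.
have -> : H T - H 0 = \sum_(j < n.+1) (H (grid T n j.+1) - H (grid T n j)).
  rewrite -(big_mkord xpredT (fun j => H (grid T n j.+1) - H (grid T n j))).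
  by rewrite telescope_sumr// grid0 grid_last.
rewrite -sumrB (le_trans (ler_norm_sum _ _ _))//.
have -> : e = \sum_(j < n.+1) e / n.+1%:R.
  by rewrite sumr_const card_ord -[RHS]mulr_natr divfK// pnatr_eq0.
apply: ler_sum => j _.
have jn : (j <= n)%N by rewrite -ltnS.
set a := grid T n j; set b := grid T n j.+1.
have aT : a \in `[0, T] by apply: grid_in => //; exact: leqW.
have bT : b \in `[0, T] by exact: grid_in.
have ab : a < b by exact: grid_lt.
have /andP[at_ tb] := htau n j jn.
have tT : tau n j \in `[0, T].
  move: aT bT; rewrite !in_itv/= => /andP[a0 _] /andP[_ bT].
  by rewrite (le_trans a0 at_) (le_trans tb bT).
have sub : `[a, b] `<=` `[0, T].
  move=> x /=; move: aT bT; rewrite !in_itv/= => /andP[a0 _] /andP[_ bT] /andP[ax xb].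
  by rewrite (le_trans a0 ax) (le_trans xb bT).
have subo x : x \in `]a, b[ -> x \in `]0, T[.
  move: aT bT; rewrite !in_itv/= => /andP[a0 _] /andP[_ bT] /andP[ax xb].
  by rewrite (le_lt_trans a0 ax) (lt_le_trans xb bT).
(* Its derivative (f - f (tau)) g is small on the cell, so the mean value theorem bounds the local
   error by e / (n + 1). *)
pose K x := H x - f (tau n j) * G x.
have dK (x : R) : x \in `]a, b[ -> is_derive x 1 K ((f x - f (tau n j)) * g x).
  move=> /subo xT.
  have h : is_derive x 1 K _ := is_deriveB (dH x xT) (is_deriveZ (f (tau n j)) (dG x xT)).
  by apply: (is_derive_eq h); rewrite mulrBl.
have cK : {within `[a, b], continuous K}.
  apply: (continuous_subspaceW sub) => x; apply: cvgB; first exact: cH.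
  by apply: cvgM; [exact: cvg_cst|exact: cG].
have [c cab cE] := MVT ab dK cK.
have -> : H b - H a - f (tau n j) * (G b - G a) = K b - K a by rewrite /K; ring.
rewrite cE normrM normrM.
have cT : c \in `[0, T].
  by apply: sub; move: cab; rewrite /= !in_itv/= => /andP[/ltW -> /ltW ->].
have fc : `|f c - f (tau n j)| <= e'.
  apply: ltW; apply: fdl => //; apply: le_lt_trans Tn.
  move: cab; rewrite in_itv/= -(gridS T n j) -/a -/b ler_norml => /andP[ac cb].
  by move: at_ tb; rewrite -/a -/b => at_ tb; apply/andP; split; lra.
rewrite (gtr0_norm (_ : 0 < b - a)) ?subr_gt0// /b /a gridS.
apply: (@le_trans _ _ (e' * (C + 1) * (T / n.+1%:R))).
  rewrite ler_wpM2r ?divr_ge0 ?(ltW T0)//; apply: ler_pM => //.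
  by rewrite (le_trans (gC c cT))// lerDl.
rewrite /e' le_eqVlt; apply/orP; left; apply/eqP; field.
apply/and3P; split; rewrite gt_eqF//.
by rewrite ltr_wpDl.
Unshelve. all: by end_near. Qed.

End riemann_sums.

(** * The rotating weights and the time average of their squares *)

Section rotation.
Context {R : realType}.
Variables (l p q T : R).

(** With [rot_sin], the real and imaginary parts of (p + i q) exp (i l (T - s)). This is the adjoint
    flow: without noise, rot_cos x + rot_sin y is constant in s and equals p x + q y at s = T. *)
Definition rot_cos (s : R) : R := p * cos (l * (T - s)) - q * sin (l * (T - s)).
Definition rot_sin (s : R) : R := p * sin (l * (T - s)) + q * cos (l * (T - s)).

Let is_derive_phase (s : R) : is_derive s 1 (fun s => l * (T - s)) (- l).
Proof.
rewrite -[- l]mulrN1; apply: (@is_deriveZ _ _ _ (fun s => T - s) l).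
by rewrite -[-1]add0r; apply: is_deriveB.
Qed.

Lemma is_derive_rot_cos (s : R) : is_derive s 1 rot_cos (l * rot_sin s).
Proof.
have ds := @is_derive1_comp _ sin (fun s => l * (T - s)) s _ _ (is_derive_sin _) (is_derive_phase s).
have dc := @is_derive1_comp _ cos (fun s => l * (T - s)) s _ _ (is_derive_cos _) (is_derive_phase s).
have h : is_derive s 1 rot_cos _ := is_deriveB (is_deriveZ p dc) (is_deriveZ q ds).
by apply: (is_derive_eq h); rewrite /rot_sin /GRing.scale/=; ring.
Qed.

Lemma is_derive_rot_sin (s : R) : is_derive s 1 rot_sin (- (l * rot_cos s)).
Proof.
have ds := @is_derive1_comp _ sin (fun s => l * (T - s)) s _ _ (is_derive_sin _) (is_derive_phase s).
have dc := @is_derive1_comp _ cos (fun s => l * (T - s)) s _ _ (is_derive_cos _) (is_derive_phase s).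
have h : is_derive s 1 rot_sin _ := is_deriveD (is_deriveZ p ds) (is_deriveZ q dc).
by apply: (is_derive_eq h); rewrite /rot_cos /GRing.scale/=; ring.
Qed.

Lemma rot_sqrD s : rot_cos s ^+ 2 + rot_sin s ^+ 2 = p ^+ 2 + q ^+ 2.
Proof.
rewrite /rot_cos /rot_sin; have := cos2Dsin2 (l * (T - s)).
move: (cos _) (sin _) => c u cu.
have -> : p ^+ 2 + q ^+ 2 = (p ^+ 2 + q ^+ 2) * (c ^+ 2 + u ^+ 2) by rewrite cu mulr1.
ring.
Qed.

Lemma rot_cos_bound s : `|rot_cos s| <= `|p| + `|q|.
Proof.
rewrite /rot_cos (le_trans (ler_normB _ _))// lerD// normrM ler_piMr//.
  by rewrite ler_norml cos_geN1 cos_le1.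
by rewrite ler_norml sin_geN1 sin_le1.
Qed.

Lemma rot_sin_bound s : `|rot_sin s| <= `|p| + `|q|.
Proof.
rewrite /rot_sin (le_trans (ler_normD _ _))// lerD// normrM ler_piMr//.
  by rewrite ler_norml sin_geN1 sin_le1.
by rewrite ler_norml cos_geN1 cos_le1.
Qed.

Lemma rot_cosT : rot_cos T = p.
Proof. by rewrite /rot_cos subrr mulr0 cos0 sin0 mulr1 mulr0 subr0. Qed.

Lemma rot_sinT : rot_sin T = q.
Proof. by rewrite /rot_sin subrr mulr0 cos0 sin0 mulr1 mulr0 add0r. Qed.

Lemma within_continuous_is_derive (f g : R -> R) (A : set R) :
  (forall s : R, is_derive s 1 f (g s)) -> {within A, continuous f}.
Proof.
move=> df; apply: continuous_subspaceT => s.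
by apply: differentiable_continuous; apply/derivable1_diffP; have [] := df s.
Qed.

(** The square of rot_sin is (p^2 + q^2) / 2 plus the derivative of rot_cos rot_sin / (2 l): its
    mean value plus an oscillation whose integral is bounded in T. *)
Lemma cvg_rot_sin_sqr : 0 < T -> l != 0 ->
  (fun n => \sum_(j < n.+1) rot_sin (grid T n j) ^+ 2 * (grid T n j.+1 - grid T n j))
  @ \oo --> (p ^+ 2 + q ^+ 2) * T / 2 +
      (rot_cos T * rot_sin T - rot_cos 0 * rot_sin 0) / (2 * l).
Proof.
move=> T0 l0.
pose H (s : R) := (p ^+ 2 + q ^+ 2) / 2 * s + (2 * l)^-1 * (rot_cos s * rot_sin s).
have dH (s : R) : is_derive s 1 H (rot_sin s ^+ 2).
  have := is_deriveD (is_deriveZ ((p ^+ 2 + q ^+ 2) / 2) (is_derive_id s 1))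
    (is_deriveZ (2 * l)^-1 (is_deriveM (is_derive_rot_cos s) (is_derive_rot_sin s))).
  move=> h; have h' : is_derive s 1 H _ := h.
  apply: (is_derive_eq h'); rewrite -(rot_sqrD s) /GRing.scale/=.
  by field; rewrite l0.
have cs : {within `[0, T], continuous (fun s => rot_sin s ^+ 2)}.
  rewrite (_ : (fun s => _) = (fun s => rot_sin s * rot_sin s)); last first.
    by apply/funext => s; rewrite expr2.
  by move=> s; apply: cvgM; apply: (within_continuous_is_derive is_derive_rot_sin).
have := @cvg_riemann_stieltjes R (fun s => rot_sin s ^+ 2) (cst 1) id H T 1 (grid T) T0 cs.
have -> : H T - H 0 = (p ^+ 2 + q ^+ 2) * T / 2 +
      (rot_cos T * rot_sin T - rot_cos 0 * rot_sin 0) / (2 * l).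
  by rewrite /H; field.
apply.
- by apply: continuous_subspaceT => s; exact: cvg_id.
- exact: within_continuous_is_derive dH.
- by move=> s _; apply: (is_derive_eq (dH s)); rewrite mulr1.
- by move=> s _; rewrite normr1.
- by move=> n j _; rewrite lexx ltW// grid_lt.
Qed.

End rotation.

Section oscillator.
Context {R : realType}.
Local Notation mu := (@lebesgue_measure R).
Variables (l T x0 y0 : R) (x y b : R -> R).
Hypothesis T_gt0 : 0 < T.
Hypotheses (cx : {within `[0, +oo[, continuous x})
  (cy : {within `[0, +oo[, continuous y}) (cb : {within `[0, +oo[, continuous b}).
Hypothesis xE : forall t, 0 <= t -> x t = x0 + l * \int[mu]_(s in `[0, t]) y s.
Hypothesis yE : forall t, 0 <= t ->
  y t = y0 - l * \int[mu]_(s in `[0, t]) x s + b t.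

Let int (f : R -> R) (t : R) := \int[mu]_(s in `[0, t]) f s.

Let segW (f : R -> R) : {within `[0, +oo[, continuous f} ->
  {within `[0, T], continuous f}.
Proof.
by apply: continuous_subspaceW => s; rewrite /= !in_itv/= => /andP[->].
Qed.

Let integrable_seg (f : R -> R) : {within `[0, +oo[, continuous f} ->
  mu.-integrable `[0, T] (EFin \o f).
Proof.
move=> cf; apply: continuous_compact_integrable; first exact: segment_compact.
exact: segW.
Qed.

Let continuous_int (f : R -> R) : {within `[0, +oo[, continuous f} ->
  {within `[0, T], continuous (int f)}.
Proof.
move=> cf; apply: parameterized_integral_continuous; first exact: ltW.
exact: integrable_seg.
Qed.

Let is_derive_int (f : R -> R) (s : R) : {within `[0, +oo[, continuous f} -> s \in `]0, T[ ->
  is_derive s 1 (int f) (f s).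
Proof.
move=> cf; rewrite in_itv/= => /andP[s0 sT].
have cs : {for s, continuous f}.
  have [h _ _] := (continuous_within_itvP f T_gt0).1 (segW cf).
  by apply: h; rewrite in_itv/= s0 sT.
have [ds d1] := continuous_FTC1_closed sT (integrable_seg cf) s0 cs.
exact: DeriveDef ds (etrans (esym (derive1E _ _)) d1).
Qed.

(* Summation by parts, with [- (rot_cos * x + rot_sin * (y - b))] a primitive of
   [b * rot_sin^`()]. *)
Lemma oscillator_stochastic_sum (p q : R) : b 0 = 0 ->
  (fun n => \sum_(j < n.+1)
     rot_sin l p q T (grid T n j) * (b (grid T n j.+1) - b (grid T n j)))
  @ \oo --> p * x T + q * y T -
     (rot_cos l p q T 0 * x0 + rot_sin l p q T 0 * y0).
Proof.
move=> b0; pose phi := rot_cos l p q T; pose psi := rot_sin l p q T.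
(* [Z] is y without the noise. It is differentiable although y is not, and [X] agrees with x on
   nonnegative times. *)
pose X (s : R) := x0 + l * int y s; pose Z (s : R) := y0 - l * int x s.
pose H (s : R) := - (phi s * X s + psi s * Z s).
have XE s : 0 <= s -> X s = x s by move=> ?; rewrite xE.
have ZE s : 0 <= s -> Z s = y s - b s by move=> ?; rewrite yE// /Z /int; ring.
have i0 f : int f 0 = 0 by rewrite /int set_itv1 Rintegral_set1.
have dX (s : R) : s \in `]0, T[ -> is_derive s 1 X (l * y s).
  move=> sT; have h : is_derive s 1 X _ :=
    is_deriveD (is_derive_cst x0 s 1) (is_deriveZ l (is_derive_int cy sT)).
  by apply: (is_derive_eq h); rewrite add0r.
have dZ (s : R) : s \in `]0, T[ -> is_derive s 1 Z (- (l * x s)).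
  move=> sT; have h : is_derive s 1 Z _ :=
    is_deriveB (is_derive_cst y0 s 1) (is_deriveZ l (is_derive_int cx sT)).
  by apply: (is_derive_eq h); rewrite sub0r.
have dphi (s : R) := is_derive_rot_cos l p q T s.
have dpsi (s : R) := is_derive_rot_sin l p q T s.
have dH (s : R) : s \in `]0, T[ -> is_derive s 1 H (b s * - (l * phi s)).
  move=> sT; have h : is_derive s 1 H _ := is_deriveN
    (is_deriveD (is_deriveM (dphi s) (dX s sT)) (is_deriveM (dpsi s) (dZ s sT))).
  apply: (is_derive_eq h); rewrite /GRing.scale/=.
  have s0 : 0 <= s by move: sT; rewrite in_itv/= => /andP[/ltW].
  have -> : x s = X s by rewrite XE.
  have -> : y s = Z s + b s by rewrite ZE// subrK.
  by rewrite /phi; ring.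
have cphi : {within `[0, T], continuous phi} by exact: within_continuous_is_derive dphi.
have cpsi : {within `[0, T], continuous psi} by exact: within_continuous_is_derive dpsi.
have cX : {within `[0, T], continuous X}.
  move=> s; apply: cvgD; first exact: cvg_cst.
  by apply: cvgM; [exact: cvg_cst|exact: continuous_int].
have cZ : {within `[0, T], continuous Z}.
  move=> s; apply: cvgB; first exact: cvg_cst.
  by apply: cvgM; [exact: cvg_cst|exact: continuous_int].
have cH : {within `[0, T], continuous H}.
  move=> s; apply: cvgN; apply: cvgD; apply: cvgM;
    [exact: cphi|exact: cX|exact: cpsi|exact: cZ].
(* The stochastic sum takes its weights at left endpoints, so after summation by parts b is
   evaluated at right endpoints. *)
have := @cvg_riemann_stieltjes R b (fun s => - (l * phi s)) psi H T
  (`|l| * (`|p| + `|q|)) (fun n j => grid T n j.+1) T_gt0 (segW cb) cpsi cH.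
move=> /(_ (fun s _ => dpsi s) dH) cvgS.
have -> : p * x T + q * y T - (rot_cos l p q T 0 * x0 + rot_sin l p q T 0 * y0) =
    psi T * b T - (H T - H 0).
  have -> : H T = - (p * x T + q * (y T - b T)).
    by rewrite /H XE ?ZE ?(ltW T_gt0)// /phi /psi rot_cosT rot_sinT.
  have -> : H 0 = - (phi 0 * x0 + psi 0 * y0).
    by rewrite /H /X /Z !i0 !mulr0 addr0 subr0.
  by rewrite {1}/psi rot_sinT /phi /psi; ring.
rewrite [X in X @ _ --> _](_ : _ = (fun n => psi T * b T -
  \sum_(j < n.+1) b (grid T n j.+1) * (psi (grid T n j.+1) - psi (grid T n j)))).
  apply: cvgB; first exact: cvg_cst.
  apply: cvgS.
  - move=> s _; rewrite normrN normrM ler_wpM2l//; exact: rot_cos_bound.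
  - by move=> n j _; rewrite lexx ltW// grid_lt.
apply/funext => n; apply/eqP; rewrite eq_sym subr_eq eq_sym -big_split/=; apply/eqP.
pose u j := psi (grid T n j) * b (grid T n j).
rewrite (eq_bigr (fun j : 'I_n.+1 => u j.+1 - u j)) => [|j _].
  rewrite -(big_mkord xpredT (fun j => u j.+1 - u j)) telescope_sumr//.
  by rewrite /u grid0 grid_last b0 mulr0 subr0.
by rewrite /u /psi; ring.
Qed.

End oscillator.

(** * The sine basis of the space of square-integrable functions *)

Section inner_product_continuity.
Context {R : realType} {V : normedModType R}.
Variable dot : V -> V -> R.
Hypothesis dotC : forall f g, dot f g = dot g f.
Hypothesis dotDl : forall f g h, dot (f + g) h = dot f h + dot g h.
Hypothesis dot_norm : forall f, dot f f = `|f| ^+ 2.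

Lemma inner_polarization f g :
  dot f g = (`|f + g| ^+ 2 - `|f| ^+ 2 - `|g| ^+ 2) / 2.
Proof.
rewrite -!dot_norm dotDl [dot f (f + g)]dotC [dot g (f + g)]dotC !dotDl [dot g f]dotC.
by field.
Qed.

(** Polarization writes the inner product through norms, which are continuous; no Cauchy-Schwarz
    inequality is involved. *)
Lemma continuous_inner g : continuous (fun f => dot f g).
Proof.
have -> : (fun f => dot f g) =
    (fun f => (`|f + g| ^+ 2 - `|f| ^+ 2 - `|g| ^+ 2) / 2).
  by apply/funext => f; exact: inner_polarization.
move=> f; apply: cvgM; last exact: cvg_cst.
apply: cvgB; last exact: cvg_cst.
apply: cvgB; rewrite !expr2; under eq_fun do rewrite expr2.
  by apply: cvgM; apply: cvg_norm; apply: cvgD; [exact: cvg_id|exact: cvg_cst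
    |exact: cvg_id|exact: cvg_cst].
by apply: cvgM; apply: cvg_norm; exact: cvg_id.
Qed.

End inner_product_continuity.

Section L2_inner_product.
Context {d : measure_display} {T : measurableType d} {R : realType}.
Variable mu : {measure set T -> \bar R}.
Implicit Types (f g h : L2 mu) (F G : LfunType mu (lee1n 2)).

Lemma integrable_Lfun2M F G :
  mu.-integrable [set: T] (fun x => (F x * G x)%:E).
Proof. exact: (Lfun1_integrable _ _).1 (Lfun2_mul_Lfun1 (LfunP F) (LfunP G)). Qed.

Lemma L2_dot_class F G :
  L2_dot (L2_class F) (L2_class G) = \int[mu]_x (F x * G x).
Proof.
congr fine; apply: ae_eq_integral => //.
- by apply/measurable_EFinP; apply: measurable_funM.
- by apply/measurable_EFinP; apply: measurable_funM.
by apply: filterS2 (L2_reprE F) (L2_reprE G) => x /= -> -> _.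
Qed.

Lemma L2_dotC f g : L2_dot f g = L2_dot g f.
Proof. by apply: eq_Rintegral => x _; rewrite mulrC. Qed.

Lemma L2_dotDl f g h : L2_dot (f + g) h = L2_dot f h + L2_dot g h.
Proof.
rewrite -[f]L2_reprK -[g]L2_reprK -[h]L2_reprK -L2_classD !L2_dot_class.
rewrite -RintegralD//; [|exact: integrable_Lfun2M..].
by apply: eq_Rintegral => x _; rewrite -mulrDl.
Qed.

Lemma L2_dotZl (c : R) f g : L2_dot (c *: f) g = c * L2_dot f g.
Proof.
rewrite -[f]L2_reprK -[g]L2_reprK -[c *: _]L2_classZ !L2_dot_class.
rewrite -RintegralZl//; last exact: integrable_Lfun2M.
by apply: eq_Rintegral => x _; rewrite mulrA.
Qed.

Lemma L2_dot0l f : L2_dot (0 : L2 mu) f = 0.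
Proof. by rewrite -(scale0r (0 : L2 mu)) L2_dotZl mul0r. Qed.

Lemma L2_dot0r f : L2_dot f (0 : L2 mu) = 0.
Proof. by rewrite L2_dotC L2_dot0l. Qed.

Lemma L2_dot_suml I (s : seq I) (F : I -> L2 mu) g :
  L2_dot (\sum_(i <- s) F i) g = \sum_(i <- s) L2_dot (F i) g.
Proof.
exact: (big_morph (fun f => L2_dot f g) (fun _ _ => L2_dotDl _ _ _) (L2_dot0l g)).
Qed.

Lemma L2_dot_norm f : L2_dot f f = `|f| ^+ 2.
Proof.
rewrite -[f]L2_reprK L2_dot_class -[`|_|]/(L2_norm _) L2_norm_class.
set F := L2_repr f.
have nF : ('N[mu]_2[EFin \o F])%E = (fine ('N[mu]_2[EFin \o F])%E)%:E.
  by rewrite -finite_norm_fine.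
have := powR_Lnorm mu (EFin \o F) (_ : (2 : R) != 0).
rewrite pnatr_eq0/= => /(_ isT).
rewrite nF poweR_EFin powR_mulrn ?fine_ge0 ?Lnorm_ge0// => /(congr1 fine) /= ->.
congr fine; apply: eq_integral => x _.
by rewrite powR_mulrn// -normrX ger0_norm ?sqr_ge0// expr2.
Qed.

Lemma continuous_L2_dot g : continuous (fun f : L2 mu => L2_dot f g).
Proof. exact: continuous_inner L2_dotC L2_dotDl L2_dot_norm g. Qed.

Implicit Types (u v w : CL2 mu).

Lemma CL2_dotE u v : CL2_dot u v = L2_dot u.1 v.1 + L2_dot u.2 v.2.
Proof. by []. Qed.

Lemma CL2_dotC u v : CL2_dot u v = CL2_dot v u.
Proof. by rewrite !CL2_dotE (L2_dotC u.1) (L2_dotC u.2). Qed.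

Lemma CL2_dotDl u v w : CL2_dot (u + v) w = CL2_dot u w + CL2_dot v w.
Proof. by rewrite !CL2_dotE /= !L2_dotDl addrACA. Qed.

Lemma CL2_dotZl (c : R) u v : CL2_dot (c *: u) v = c * CL2_dot u v.
Proof. by rewrite !CL2_dotE /= !L2_dotZl mulrDr. Qed.

Lemma CL2_dot_norm u : CL2_dot u u = `|u| ^+ 2.
Proof.
rewrite CL2_dotE !L2_dot_norm -[`|u|]/(CL2_norm u) sqr_sqrtr//.
Qed.

Lemma CL2_dot_eq0 u : CL2_dot u u = 0 -> u = 0.
Proof. by rewrite CL2_dot_norm => /eqP; rewrite sqrf_eq0 normr_eq0 => /eqP. Qed.

Lemma continuous_CL2_dot v : continuous (fun u : CL2 mu => CL2_dot u v).
Proof. exact: continuous_inner CL2_dotC CL2_dotDl CL2_dot_norm v. Qed.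

End L2_inner_product.

Section restricted_integral.
Context {d : measure_display} {T : measurableType d} {R : realType}.
Variables (m : {measure set T -> \bar R}) (D : set T) (mD : measurable D).

Let ge0_integral_mrestr (f : T -> \bar R) : measurable_fun [set: T] f ->
  (forall x, 0 <= f x)%E ->
  (\int[mrestr m mD]_x f x = \int[m]_(x in D) f x)%E.
Proof.
move=> mf f0.
rewrite (@ge0_negligible_integral _ _ _ (mrestr m mD) setT (~` D))//; last 2 first.
- exact: measurableC.
- by transitivity (m (~` D `&` D)) => //; rewrite setICl measure0.
rewrite setTD setCK; apply: eq_measure_integral => A mA AD.
by transitivity (m (A `&` D)) => //; rewrite setIidl.
Qed.

Lemma Rintegral_mrestr (f : T -> R) : measurable_fun [set: T] f ->
  \int[mrestr m mD]_x f x = \int[m]_(x in D) f x.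
Proof.
move=> /measurable_EFinP mf; congr fine.
rewrite [LHS]integralE [RHS]integralE; congr (_ - _)%E.
- by apply: ge0_integral_mrestr => //; exact: measurable_funepos.
- by apply: ge0_integral_mrestr => //; exact: measurable_funeneg.
Qed.

Lemma integral_mrestr (f : T -> \bar R) : measurable_fun [set: T] f ->
  (\int[mrestr m mD]_x f x = \int[m]_(x in D) f x)%E.
Proof.
move=> mf; rewrite [LHS]integralE [RHS]integralE; congr (_ - _)%E.
- by apply: ge0_integral_mrestr => //; exact: measurable_funepos.
- by apply: ge0_integral_mrestr => //; exact: measurable_funeneg.
Qed.

End restricted_integral.

(** * Continuous representatives and weak derivatives *)

Section continuous_classes.
Context {R : realType}.
Local Notation leb := (@lebesgue_measure R).

Lemma Rintegral_mu0pi (f : R -> R) : continuous f ->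
  \int[mu0pi R]_x f x = \int[leb]_(x in `[0, pi]) f x.
Proof.
move=> cf.
have cin : leb.-integrable `[0, pi] (EFin \o f).
  apply: continuous_compact_integrable; first exact: segment_compact.
  exact: continuous_subspaceT.
have cin' : leb.-integrable `[0, pi[ (EFin \o f).
  by apply: integrableS cin => //; apply: subset_itvl; rewrite bnd_simp.
rewrite /mu0pi Rintegral_mrestr; last exact: continuous_measurable_fun.
rewrite -Rintegral_itv_bndo_bndc// -Rintegral_itv_obnd_cbnd//.
by apply: integrableS cin' => //; apply: subset_itvr; rewrite bnd_simp.
Qed.

Fact continuous_Lfun (f : R -> R) : continuous f ->
  (f : measurableTypeR R -> R) \in Lfun (mu0pi R) 2%:E.
Proof.
move=> cf; have mf : measurable_fun [set: measurableTypeR R] f.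
  exact: continuous_measurable_fun.
rewrite inE; apply/andP; split; rewrite inE//=.
rewrite /finite_norm unlock poweR_lty//.
have cf2 : continuous (fun x => f x ^+ 2).
  by under eq_fun do rewrite expr2; move=> x; apply: cvgM; exact: cf.
under eq_integral do rewrite /= powR_mulrn// -normrX ger0_norm ?sqr_ge0//.
rewrite /mu0pi integral_mrestr; last first.
  by apply/measurable_EFinP; exact: continuous_measurable_fun.
have cin : leb.-integrable `[0, pi] (EFin \o (fun x => f x ^+ 2)).
  apply: continuous_compact_integrable; first exact: segment_compact.
  exact: continuous_subspaceT.
apply: (@le_lt_trans _ _ (\int[leb]_(x in `[0%R, pi]) (f x ^+ 2)%:E)%E).
  apply: ge0_subset_integral => //=.
  - by apply/measurable_EFinP/measurable_funTS; exact: continuous_measurable_fun.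
  - by move=> x _; rewrite lee_fin sqr_ge0.
  - exact: subset_itv_oo_cc.
by have := integrable_fin_num _ cin; rewrite ge0_fin_numE//;
  [apply|apply: integral_ge0 => x _; rewrite lee_fin sqr_ge0].
Qed.

Definition cclass (f : R -> R) (cf : continuous f) : U0 R :=
  L2_class (Lfun_Sub (lee1n 2) (continuous_Lfun cf)).

Lemma cclass_dot f g (cf : continuous f) (cg : continuous g) :
  L2_dot (cclass cf) (cclass cg) = \int[leb]_(x in `[0, pi]) (f x * g x).
Proof.
rewrite L2_dot_class /=; apply: Rintegral_mu0pi => x.
by apply: cvgM; [exact: cf|exact: cg].
Qed.

Lemma cclass_eq f (cf : continuous f) (F : LfunType (mu0pi R) (lee1n 2)) :
  f =1 F -> cclass cf = L2_class F.
Proof. by move=> fF; apply/L2_classP; apply: aeW => x /=; rewrite fF. Qed.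

Lemma cclassD f g h (cf : continuous f) (cg : continuous g) (ch : continuous h) :
  (forall x, h x = f x + g x) -> cclass ch = cclass cf + cclass cg.
Proof. by move=> hE; rewrite -L2_classD; apply: cclass_eq => x; rewrite hE. Qed.

Lemma cclassZ (c : R) f h (cf : continuous f) (ch : continuous h) :
  (forall x, h x = c * f x) -> cclass ch = c *: cclass cf.
Proof. by move=> hE; rewrite -[RHS]L2_classZ; apply: cclass_eq => x; rewrite hE. Qed.

Lemma derivable_continuous (f : R -> R) : (forall x, derivable f x 1) -> continuous f.
Proof. by move=> df x; apply/differentiable_continuous/derivable1_diffP. Qed.

Lemma continuous_derivable_LR (f : R -> R) (a b : R) : (forall x, derivable f x 1) ->
  derivable_oo_LRcontinuous f a b.
Proof.
move=> df; have cf := derivable_continuous df; split => [x _||].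
- exact: df.
- by apply: cvg_at_right_filter; exact: cf.
- by apply: cvg_at_left_filter; exact: cf.
Qed.

Lemma weak_derivative_cclass (f g : R -> R) (cf : continuous f) (cg : continuous g) :
  (forall x : R, is_derive x 1 f (g x)) -> weak_derivative (cclass cf) (cclass cg).
Proof.
move=> df phi [dphi [a [b [a0 bpi phi0]]]].
have d0 x : derivable phi x 1 by exact: (dphi 0%N).
have cphi := derivable_continuous d0.
have cphi' : continuous (derive1 phi) by apply: derivable_continuous; exact: (dphi 1%N).
have E h (ch : continuous h) (k : R -> R) : continuous k ->
    \int[mu0pi R]_x (L2_repr (cclass ch) x * k x) =
    \int[leb]_(x in `[0, pi]) (h x * k x).
  move=> ck; rewrite -Rintegral_mu0pi => [|x]; last first.
    by apply: cvgM; [exact: ch|exact: ck].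
  congr fine; apply: ae_eq_integral => //.
  - apply/measurable_EFinP; apply: measurable_funM => //.
    exact: continuous_measurable_fun.
  - apply/measurable_EFinP; apply: measurable_funM; exact: continuous_measurable_fun.
  by apply: filterS (L2_reprE (Lfun_Sub (lee1n 2) (continuous_Lfun ch))) => x /= -> _.
rewrite !E//.
have dfx (x : R) : x \in `]0, pi[ -> derive1 f x = g x.
  by move=> _; rewrite derive1E; have [_ ->] := df x.
have dfLR : derivable_oo_LRcontinuous f 0 pi.
  by apply: continuous_derivable_LR => x; have [] := df x.
have dphiLR : derivable_oo_LRcontinuous phi 0 pi by exact: continuous_derivable_LR.
have cgs : {within `[0, pi], continuous g} by exact: continuous_subspaceT.
have cphis : {within `[0, pi], continuous (derive1 phi)} by exact: continuous_subspaceT.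
have -> := Rintegration_by_parts (pi_gt0 R) cgs dfLR dfx cphis dphiLR (fun x _ => erefl).
rewrite (phi0 pi) ?(phi0 0) ?mulr0 ?subr0 ?sub0r//.
- by move=> /andP[+ _]; rewrite leNgt a0.
- by move=> /andP[_]; rewrite leNgt bpi.
Qed.

Lemma dirichlet_laplacian_cclass (f g h : R -> R) (cf : continuous f)
    (cg : continuous g) (ch : continuous h) :
  (forall x : R, is_derive x 1 f (g x)) -> (forall x : R, is_derive x 1 g (h x)) ->
  f 0 = 0 -> f pi = 0 -> real_dirichlet_laplacian (cclass cf) (cclass ch).
Proof.
move=> df dg f0 fpi; split; last first.
  by exists (cclass cg); exact: weak_derivative_cclass.
split; first by exists (cclass cg); exact: weak_derivative_cclass.
exists f; split=> //; first exact: continuous_subspaceT.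
exact: (L2_reprE (Lfun_Sub (lee1n 2) (continuous_Lfun cf))).
Qed.

(** A sufficient condition for membership in the domain of the Laplacian that is visibly stable
    under linear combinations, as it is stated on honest functions. *)
Definition smooth_dirichlet_pair (f h : U0 R) : Prop :=
  exists (F G H : R -> R) (cF : continuous F) (cH : continuous H),
    [/\ f = cclass cF, h = cclass cH, continuous G,
      forall x : R, is_derive x 1 F (G x) /\ is_derive x 1 G (H x) &
      F 0 = 0 /\ F pi = 0].

Lemma smooth_dirichlet_pair_laplacian f h :
  smooth_dirichlet_pair f h -> real_dirichlet_laplacian f h.
Proof.
move=> [F [G [H [cF [cH [-> -> cG dFG [F0 Fpi]]]]]]].
by apply: (@dirichlet_laplacian_cclass _ _ _ cF cG cH) => // x; have [] := dFG x.
Qed.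

Lemma smooth_dirichlet_pair_lin (c : R) f h f' h' :
  smooth_dirichlet_pair f h -> smooth_dirichlet_pair f' h' ->
  smooth_dirichlet_pair (c *: f + f') (c *: h + h').
Proof.
move=> [F [G [H [cF [cH [-> -> cG dFG [F0 Fpi]]]]]]].
move=> [F' [G' [H' [cF' [cH' [-> -> cG' dFG' [F0' Fpi']]]]]]].
have lin (A B : R -> R) : continuous A -> continuous B ->
    continuous (fun x : R => c * A x) /\ continuous (fun x : R => c * A x + B x).
  move=> cA cB; have cA' : continuous (fun x : R => c * A x).
    by move=> x; apply: cvgM; [exact: cvg_cst|exact: cA].
  by split=> // x; apply: cvgD; [exact: cA'|exact: cB].
have [cF1 cF2] := lin _ _ cF cF'; have [cH1 cH2] := lin _ _ cH cH'.
have [_ cG2] := lin _ _ cG cG'.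
exists (fun x : R => c * F x + F' x), (fun x : R => c * G x + G' x),
  (fun x : R => c * H x + H' x), cF2, cH2; split=> //.
- by rewrite (@cclassD _ _ _ cF1 cF' cF2)// (@cclassZ c _ _ cF cF1).
- by rewrite (@cclassD _ _ _ cH1 cH' cH2)// (@cclassZ c _ _ cH cH1).
- move=> x; have [dF dG] := dFG x; have [dF' dG'] := dFG' x.
  have h1 : is_derive x 1 (fun x : R => c * F x + F' x) _ := is_deriveD (is_deriveZ c dF) dF'.
  have h2 : is_derive x 1 (fun x : R => c * G x + G' x) _ := is_deriveD (is_deriveZ c dG) dG'.
  by split; [apply: (is_derive_eq h1)|apply: (is_derive_eq h2)].
- by rewrite F0 F0' Fpi Fpi' !mulr0 addr0.
Qed.

Lemma smooth_dirichlet_pair0 : smooth_dirichlet_pair 0 0.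
Proof.
have c0 : continuous (fun _ : R => 0 : R) by move=> x; exact: cvg_cst.
have E : 0 = cclass c0.
  by rewrite (@cclassZ 0 _ _ c0 c0) ?scale0r// => x; rewrite mul0r.
exists (fun=> 0), (fun=> 0), (fun=> 0), c0, c0; split=> // x.
by split; exact: is_derive_cst.
Qed.

End continuous_classes.

Section sine_basis.
Context {R : realType}.
Local Notation leb := (@lebesgue_measure R).

Lemma sin_natpi k : sin (k%:R * pi : R) = 0.
Proof.
by elim: k => [|k IH]; rewrite ?mul0r ?sin0// -natr1 mulrDl mul1r sinDpi IH oppr0.
Qed.

Lemma is_derive_sinM (c x : R) : is_derive x 1 (fun x => sin (c * x)) (c * cos (c * x)).
Proof.
have h := @is_derive1_comp _ sin (fun x => c * x) x _ _ (is_derive_sin _)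
  (is_deriveZ c (is_derive_id x 1)).
by apply: (is_derive_eq h); rewrite /GRing.scale/= mulr1 mulrC.
Qed.

Lemma is_derive_cosM (c x : R) : is_derive x 1 (fun x => cos (c * x)) (- (c * sin (c * x))).
Proof.
have h := @is_derive1_comp _ cos (fun x => c * x) x _ _ (is_derive_cos _)
  (is_deriveZ c (is_derive_id x 1)).
by apply: (is_derive_eq h); rewrite /GRing.scale/= mulr1; ring.
Qed.

Lemma is_derive_continuous (f g : R -> R) : (forall x : R, is_derive x 1 f (g x)) ->
  continuous f.
Proof. by move=> df; apply: derivable_continuous => x; have [] := df x. Qed.

Lemma Rintegral_FTC (f F : R -> R) : continuous f ->
  (forall x : R, is_derive x 1 F (f x)) ->
  \int[leb]_(x in `[0, pi]) f x = F pi - F 0.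
Proof.
move=> cf dF; have dLR : derivable_oo_LRcontinuous F 0 pi.
  by apply: continuous_derivable_LR => x; have [] := dF x.
have d1 (x : R) : x \in `]0, pi[ -> derive1 F x = f x.
  by move=> _; rewrite derive1E; have [_ ->] := dF x.
by rewrite /Rintegral (continuous_FTC2 (pi_gt0 R) (continuous_subspaceT cf) dLR d1).
Qed.

Lemma continuous_sinM (c : R) : continuous (fun x : R => sin (c * x)).
Proof. exact: is_derive_continuous (is_derive_sinM c). Qed.

Lemma integral_sin_sin (i j : nat) : (0 < i)%N -> (0 < j)%N ->
  \int[leb]_(x in `[0, pi]) (sin (i%:R * x) * sin (j%:R * x)) =
  (i == j)%:R * (pi / 2).
Proof.
move=> i0 j0; have cs : continuous (fun x : R => sin (i%:R * x) * sin (j%:R * x)).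
  by move=> x; apply: cvgM; exact: continuous_sinM.
have i0' : i%:R != 0 :> R by rewrite pnatr_eq0 -lt0n.
have [ij|ij] := eqVneq i j.
  subst j; pose F (x : R) := 2^-1 * x - (4 * i%:R)^-1 * sin (2 * i%:R * x).
  have dF (x : R) : is_derive x 1 F (sin (i%:R * x) * sin (i%:R * x)).
    have h : is_derive x 1 F _ := is_deriveB (is_deriveZ 2^-1 (is_derive_id x 1))
      (is_deriveZ (4 * i%:R)^-1 (is_derive_sinM (2 * i%:R) x)).
    apply: (is_derive_eq h); rewrite /GRing.scale/=.
    have -> : 2 * i%:R * x = i%:R * x + i%:R * x by ring.
    rewrite cosD; have := cos2Dsin2 (i%:R * x); move: (cos _) (sin _) => c s cs1.
    have -> : c * c = 1 - s * s by rewrite -cs1; ring.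
    by field.
  by rewrite (Rintegral_FTC cs dF) /F -[2 * i%:R]natrM sin_natpi !mulr0 sin0 mul1r; ring.
have dij : i%:R - j%:R != 0 :> R by rewrite subr_eq0 eqr_nat.
have sij : i%:R + j%:R != 0 :> R by rewrite -natrD pnatr_eq0 addn_eq0 negb_and -lt0n i0.
pose F (x : R) := (2 * (i%:R - j%:R))^-1 * sin ((i%:R - j%:R) * x)
  - (2 * (i%:R + j%:R))^-1 * sin ((i%:R + j%:R) * x).
have dF (x : R) : is_derive x 1 F (sin (i%:R * x) * sin (j%:R * x)).
  have h : is_derive x 1 F _ := is_deriveB
    (is_deriveZ (2 * (i%:R - j%:R))^-1 (is_derive_sinM (i%:R - j%:R) x))
    (is_deriveZ (2 * (i%:R + j%:R))^-1 (is_derive_sinM (i%:R + j%:R) x)).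
  apply: (is_derive_eq h); rewrite /GRing.scale/=.
  rewrite [(i%:R - j%:R) * x]mulrBl [(i%:R + j%:R) * x]mulrDl cosB cosD.
  by field; rewrite dij sij.
rewrite (Rintegral_FTC cs dF) mul0r /F !mulr0 sin0 -natrD sin_natpi mulrBl sinB !sin_natpi; ring.
Qed.

Lemma continuous_sine k : continuous (@sine R k).
Proof.
by move=> x; apply: cvgM; [exact: cvg_cst|exact: continuous_sinM].
Qed.

Lemma e_cclass k : e_ k = cclass (@continuous_sine k).
Proof. by apply/esym/cclass_eq. Qed.

Lemma e_orthonormal (i j : nat) : (0 < i)%N -> (0 < j)%N ->
  L2_dot (@e_ R i) (e_ j) = (i == j)%:R.
Proof.
move=> i0 j0; rewrite !e_cclass cclass_dot.
have E : \int[leb]_(x in `[0, pi]) (sine i x * sine j x) =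
    \int[leb]_(x in `[0, pi]) (2 / pi * (sin (i%:R * x) * sin (j%:R * x))).
  apply: eq_Rintegral => x _; rewrite /sine mulrACA -expr2 sqr_sqrtr//.
  by rewrite divr_ge0// pi_ge0.
rewrite E RintegralZl//; last first.
  apply: continuous_compact_integrable; first exact: segment_compact.
  apply: continuous_subspaceT => x.
  by apply: cvgM; exact: continuous_sinM.
rewrite integral_sin_sin//; have := pi_gt0 R => p0.
have pn : pi != 0 :> R by rewrite gt_eqF.
by rewrite mulrCA mulf_div [pi * 2]mulrC divff ?mulr1// mulf_neq0.
Qed.

Lemma smooth_dirichlet_pair_e k :
  smooth_dirichlet_pair (@e_ R k) (- (k%:R ^+ 2) *: e_ k).
Proof.
pose s := Num.sqrt (2 / pi) : R.
pose g (x : R) := s * (k%:R * cos (k%:R * x)).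
pose h (x : R) := - (k%:R ^+ 2) * @sine R k x.
have df (x : R) : is_derive x 1 (@sine R k) (g x).
  have H : is_derive x 1 (@sine R k) _ := is_deriveZ s (is_derive_sinM k%:R x).
  by apply: (is_derive_eq H); rewrite /GRing.scale/=.
have dg (x : R) : is_derive x 1 g (h x).
  have H : is_derive x 1 g _ := is_deriveZ s (is_deriveZ k%:R (is_derive_cosM k%:R x)).
  by apply: (is_derive_eq H); rewrite /h /sine /GRing.scale/= -/s; ring.
have ch : continuous h.
  by move=> x; apply: cvgM; [exact: cvg_cst|exact: continuous_sine].
have cg : continuous g by exact: is_derive_continuous dg.
exists (@sine R k), g, h, (@continuous_sine k), ch; split=> //.
- exact: e_cclass.
- by rewrite e_cclass -(@cclassZ _ _ _ _ (@continuous_sine k) ch).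
- by rewrite /sine mulr0 sin0 mulr0 sin_natpi mulr0.
Qed.

End sine_basis.

(** * The Galerkin approximation *)

Section galerkin_basis.
Context {R : realType} {M : nat}.
Implicit Types (i j : 'I_(M + M)) (x y z : H0 R).

(** The wave number of a real coordinate: the left half of the indices holds the real parts, the
    right half the imaginary parts, and both are numbered from 0, whence the successors. *)
Definition mode (i : 'I_(M + M)) : nat :=
  match fintype.split i with inl k => k.+1 | inr k => k.+1 end.

(* The real basis [e_1, ..., e_M, i e_1, ..., i e_M] of [H_ M]. *)
Definition real_basis i : H0 R :=
  match fintype.split i with inl k => (e_ k.+1, 0) | inr k => (0, e_ k.+1) end.

Lemma split_lshift (k : 'I_M) : fintype.split (lshift M k) = inl k.
Proof. exact: (unsplitK (inl k)). Qed.

Lemma split_rshift (k : 'I_M) : fintype.split (rshift M k) = inr k.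
Proof. exact: (unsplitK (inr k)). Qed.

Lemma mode_lshift (k : 'I_M) : mode (lshift M k) = k.+1.
Proof. by rewrite /mode split_lshift. Qed.

Lemma mode_rshift (k : 'I_M) : mode (rshift M k) = k.+1.
Proof. by rewrite /mode split_rshift. Qed.

Lemma mode_gt0 i : (0 < mode i)%N.
Proof. by rewrite /mode; case: fintype.split. Qed.

Lemma real_basis_lshift (k : 'I_M) : real_basis (lshift M k) = (e_ k.+1, 0).
Proof. by rewrite /real_basis split_lshift. Qed.

Lemma real_basis_rshift (k : 'I_M) : real_basis (rshift M k) = (0, e_ k.+1).
Proof. by rewrite /real_basis split_rshift. Qed.

Lemma real_basis_orthonormal i j :
  CL2_dot (real_basis i) (real_basis j) = (i == j)%:R.
Proof.
have eE (k l : 'I_M) : L2_dot (@e_ R k.+1) (e_ l.+1) = (k == l)%:R.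
  by rewrite e_orthonormal// eqSS.
rewrite -(splitK i) -(splitK j).
case: (fintype.split i) => k; case: (fintype.split j) => l;
  rewrite /unsplit ?real_basis_lshift ?real_basis_rshift CL2_dotE /=
    ?L2_dot0l ?L2_dot0r ?addr0 ?add0r ?eE //.
- by rewrite eq_lrshift.
- by rewrite eq_rlshift.
- by rewrite (inj_eq (@rshift_inj _ _)).
Qed.

Definition comb (v : 'rV[R]_(M + M)) : H0 R := \sum_i v 0 i *: real_basis i.

Definition coord x : 'rV[R]_(M + M) := \row_i CL2_dot x (real_basis i).

Lemma dot_comb v i : CL2_dot (comb v) (real_basis i) = v 0 i.
Proof.
rewrite /comb (big_morph (fun x => CL2_dot x (real_basis i))
  (fun x y => CL2_dotDl x y (real_basis i)) (id1 := 0)); last first.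
  by rewrite -(scale0r (0 : H0 R)) CL2_dotZl mul0r.
rewrite (bigD1 i)//= CL2_dotZl real_basis_orthonormal eqxx mulr1.
rewrite big1 ?addr0// => j ji.
by rewrite CL2_dotZl real_basis_orthonormal (negbTE ji) mulr0.
Qed.

Lemma combK v : coord (comb v) = v.
Proof. by apply/rowP => i; rewrite mxE dot_comb. Qed.

Lemma combZ (c : R) v : comb (c *: v) = c *: comb v.
Proof.
by rewrite scaler_sumr; apply: eq_bigr => i _; rewrite mxE scalerA.
Qed.

Lemma comb_sqnorm v : `|comb v| ^+ 2 = \sum_i v 0 i ^+ 2.
Proof.
rewrite -CL2_dot_norm {2}/comb CL2_dotC.
rewrite (big_morph (fun x => CL2_dot x (comb v))
  (fun x y => CL2_dotDl x y (comb v)) (id1 := 0)); last first.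
  by rewrite -(scale0r (0 : H0 R)) CL2_dotZl mul0r.
by apply: eq_bigr => i _; rewrite CL2_dotZl CL2_dotC dot_comb expr2.
Qed.

Lemma continuous_comb : continuous comb.
Proof.
apply: (continuous_big (@add_continuous _)) => i _ v.
apply: (@continuous_comp _ _ _ (fun x : 'rV[R]_(M + M) => x 0 i)
  (fun c : R => c *: real_basis i)); first exact: coord_continuous.
exact: scalel_continuous.
Qed.

Lemma CL2_cscale_ec (c : R[i]) k :
  CL2_cscale c (@ec_ R k) = (complex.Re c *: e_ k, complex.Im c *: e_ k).
Proof. by rewrite /CL2_cscale /= !scaler0 subr0 addr0. Qed.

Lemma sum_cscale_ec (c : nat -> R[i]) :
  \sum_(1 <= k < M.+1) CL2_cscale (c k) (@ec_ R k) =
  comb (\row_i match fintype.split i with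
               | inl k => complex.Re (c k.+1) | inr k => complex.Im (c k.+1) end).
Proof.
rewrite big_add1 big_mkord /comb big_split_ord/=; set v := \row_i _.
transitivity (\sum_(k < M) (v 0 (lshift M k) *: (real_basis (lshift M k) : H0 R) +
  v 0 (rshift M k) *: (real_basis (rshift M k) : H0 R))); last exact: big_split.
apply: eq_bigr => k _.
rewrite CL2_cscale_ec !mxE split_lshift split_rshift real_basis_lshift real_basis_rshift.
by congr pair; rewrite /= scaler0 ?addr0 ?add0r.
Qed.

Lemma P_comb_coord x : P_ M x = comb (coord x).
Proof.
rewrite /P_ sum_cscale_ec; congr comb; apply/rowP => i; rewrite !mxE /real_basis.
by case: (fintype.split i) => k; rewrite /CL2_dot /= ?L2_dot0r ?addr0 ?subr0 ?add0r.
Qed.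

Lemma H_comb v : H_ M (comb v).
Proof.
(* Wave numbers above M get the default coefficient 0; only 1 to M enter the sum. *)
exists (fun k => Complex
  (oapp (fun k' : 'I_M => v 0 (lshift M k')) 0 (insub k.-1))
  (oapp (fun k' : 'I_M => v 0 (rshift M k')) 0 (insub k.-1))).
rewrite sum_cscale_ec; congr comb; apply/rowP => i; rewrite mxE -[i in LHS]splitK.
by case: (fintype.split i) => k; rewrite /= valK.
Qed.

Lemma H_comb_coord x : H_ M x -> x = comb (coord x).
Proof. by move=> [c ->]; rewrite sum_cscale_ec combK. Qed.

End galerkin_basis.

Section galerkin_laplacian.
Context {R : realType} {M : nat}.

(** [Delta] is only prescribed on its domain and is not given as a linear map, so it cannot be
    distributed over the sum: the whole combination is shown to lie in the domain, with its second
    derivative. *)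
Lemma laplacian_comb (Delta : H0 R -> H0 R) (v : 'rV[R]_(M + M)) :
  is_dirichlet_laplacian Delta ->
  Delta (comb v) = comb (\row_i (- ((mode i)%:R ^+ 2) * v 0 i)).
Proof.
move=> hD; set v' := \row_i _.
have E (u : 'rV[R]_(M + M)) : comb u = (\sum_(k < M) u 0 (lshift M k) *: e_ k.+1,
    \sum_(k < M) u 0 (rshift M k) *: e_ k.+1).
  rewrite /comb big_split_ord/=.
  under eq_bigr do rewrite real_basis_lshift.
  under [X in _ + X]eq_bigr do rewrite real_basis_rshift.
  rewrite [LHS]surjective_pairing; congr pair.
    rewrite /= !(big_morph fst (id1 := 0) (op1 := +%R))//=.
    by rewrite [X in _ + X]big1 ?addr0// => k _; rewrite /= scaler0.
  rewrite /= !(big_morph snd (id1 := 0) (op1 := +%R))//=.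
  by rewrite big1 ?add0r// => k _; rewrite /= scaler0.
have S (f : 'I_M -> R) : smooth_dirichlet_pair
    (\sum_(k < M) f k *: e_ k.+1)
    (\sum_(k < M) (- (k.+1%:R ^+ 2) * f k) *: @e_ R k.+1).
  elim/big_ind2 : _ => [|f1 h1 f2 h2 H1 H2|k _].
  - exact: smooth_dirichlet_pair0.
  - by have := smooth_dirichlet_pair_lin 1 H1 H2; rewrite !scale1r.
  - have := smooth_dirichlet_pair_lin (f k) (smooth_dirichlet_pair_e k.+1)
      smooth_dirichlet_pair0.
    by rewrite !addr0 scalerA mulrC.
apply: hD; rewrite !E /=.
- have -> : \sum_(k < M) v' 0 (lshift M k) *: @e_ R k.+1 =
      \sum_(k < M) (- (k.+1%:R ^+ 2) * v 0 (lshift M k)) *: e_ k.+1.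
    by apply: eq_bigr => k _; rewrite mxE mode_lshift.
  exact/smooth_dirichlet_pair_laplacian/S.
- have -> : \sum_(k < M) v' 0 (rshift M k) *: @e_ R k.+1 =
      \sum_(k < M) (- (k.+1%:R ^+ 2) * v 0 (rshift M k)) *: e_ k.+1.
    by apply: eq_bigr => k _; rewrite mxE mode_rshift.
  exact/smooth_dirichlet_pair_laplacian/S.
Qed.

End galerkin_laplacian.

Section square_root.
Context {R : realType} {V : lmodType R}.
Variables (dot : V -> V -> R) (A : V -> V) (B : {linear V -> V}).
Hypothesis dotDl : forall f g h, dot (f + g) h = dot f h + dot g h.
Hypothesis dotZl : forall c f g, dot (c *: f) g = c * dot f g.
Hypothesis dot_ge0 : forall f, 0 <= dot f f.
Hypothesis dot_eq0 : forall f, dot f f = 0 -> f = 0.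
Hypothesis BA : is_sqrt_operator dot A B.

(* [(B + sqrt c) (B - sqrt c) v = 0], and [B + sqrt c] is injective when [0 < c]. *)
Lemma sqrt_operator_eigenvector (c : R) v : 0 <= c -> A v = c *: v ->
  B v = Num.sqrt c *: v.
Proof.
have [[Bsym Bge0] BB] := BA => c0 Av.
move: c0; rewrite le_eqVlt => /predU1P[c0|c0].
  rewrite -c0 sqrtr0 scale0r; apply: dot_eq0.
  by rewrite -Bsym BB Av -c0 scale0r -(scale0r (0 : V)) dotZl mul0r.
pose s := Num.sqrt c; have s0 : 0 < s by rewrite sqrtr_gt0.
pose w := B v - s *: v.
have Bw : B w = - s *: w.
  rewrite /w raddfB/= BB Av linearZ/= scalerBr !scalerA mulNr -expr2 sqr_sqrtr ?ltW//.
  by rewrite scaleNr scaleNr opprK addrC.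
have : 0 <= dot (B w) w by exact: Bge0.
rewrite Bw dotZl mulNr oppr_ge0 pmulr_rle0// => w0.
have /dot_eq0/eqP : dot w w = 0 by apply/eqP; rewrite eq_le w0 dot_ge0.
by rewrite subr_eq0 => /eqP.
Qed.

End square_root.

(** * The rate function in coordinates *)

Section galerkin_rate_function.
Context {R : realType} {M : nat}.
Variables (alpha : R) (eta : nat -> R) (Q : {linear U0 R -> U0 R})
  (QMhalf : {linear H0 R -> H0 R}).
Hypothesis alpha_gt0 : 0 < alpha.
Hypothesis eta_ge0 : forall k, (0 < k)%N -> 0 <= eta k.
Hypothesis Qe : forall k, (0 < k)%N -> Q (e_ k) = eta k *: e_ k.
Hypothesis sqrtQ : is_sqrt_operator CL2_dot (complexify Q \o P_ M) QMhalf.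
Implicit Types (i : 'I_(M + M)) (x z : H0 R) (v : 'rV[R]_(M + M)).

Let eta' i := eta (mode i).

Let eta'_ge0 i : 0 <= eta' i. Proof. exact: eta_ge0 (mode_gt0 i). Qed.

Lemma QMhalf_eigenvector (c : R) x : 0 <= c -> (complexify Q \o P_ M) x = c *: x ->
  QMhalf x = Num.sqrt c *: x.
Proof.
apply: (sqrt_operator_eigenvector (@CL2_dotZl _ _ _ _) _ (@CL2_dot_eq0 _ _ _ _) sqrtQ).
by move=> f; rewrite CL2_dot_norm sqr_ge0.
Qed.

Lemma P_comb v : P_ M (comb v) = comb v.
Proof. by rewrite P_comb_coord combK. Qed.

Lemma QMhalf_real_basis i :
  QMhalf (real_basis i) = Num.sqrt (eta' i) *: real_basis i.
Proof.
apply: QMhalf_eigenvector => //=.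
have -> : P_ M (real_basis i) = real_basis i :> H0 R.
  have -> : @real_basis R M i = comb (delta_mx 0 i).
    rewrite /comb (bigD1 i)//= big1 ?addr0 => [|j ji]; first by rewrite mxE !eqxx scale1r.
    by rewrite mxE (negbTE ji) andbF scale0r.
  exact: P_comb.
rewrite /complexify /eta' /mode /real_basis.
by case: (fintype.split i) => k; rewrite /= raddf0 Qe//; congr pair;
  rewrite /= scaler0.
Qed.

(** What is orthogonal to [H_ M] is an eigenvector of Q_M for the eigenvalue 0, hence killed by the
    square root. So the range over the whole space equals the range over [H_ M]. *)
Lemma QMhalfE x :
  QMhalf x = comb (\row_i (Num.sqrt (eta' i) * CL2_dot x (real_basis i))).
Proof.
have PK : P_ M (x - P_ M x) = 0.
  rewrite P_comb_coord; set c := coord _; have -> : c = 0; last first.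
    by rewrite /comb big1// => i _; rewrite mxE scale0r.
  apply/rowP => i; rewrite !mxE -scaleN1r CL2_dotDl CL2_dotZl P_comb_coord dot_comb mxE.
  by rewrite mulN1r subrr.
have E0 : QMhalf (x - P_ M x) = Num.sqrt 0 *: (x - P_ M x).
  apply: QMhalf_eigenvector => //=.
  by rewrite PK scale0r /complexify /= raddf0.
move: E0; rewrite sqrtr0 scale0r raddfB/= => /eqP; rewrite subr_eq0 => /eqP ->.
rewrite P_comb_coord /comb raddf_sum/=; apply: eq_bigr => i _.
by rewrite linearZ/= QMhalf_real_basis scalerA !mxE mulrC.
Qed.

Let a i := alpha ^+ 2 * eta' i / 2.

Let a_eq0 i : (a i == 0) = (eta' i == 0).
Proof. by rewrite /a mulf_eq0 invr_eq0 pnatr_eq0 orbF mulf_eq0 sqrf_eq0 gt_eqF. Qed.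

(** As [0^-1 = 0], the coordinates along the kernel are set to zero, which makes this preimage the
    one of minimal norm. *)
Let pre v := \row_i ((Num.sqrt (eta' i))^-1 * v 0 i).

Let QMhalf_pre v : (forall i, eta' i == 0 -> v 0 i == 0) ->
  QMhalf (comb (pre v)) = comb v.
Proof.
move=> h; rewrite QMhalfE; congr comb; apply/rowP => i; rewrite mxE dot_comb mxE.
have [e0|e0] := eqVneq (eta' i) 0.
  by rewrite e0 sqrtr0 mul0r (eqP (h i _)) ?e0.
by rewrite mulVKf// gt_eqF// sqrtr_gt0 lt0r e0 eta'_ge0.
Qed.

Lemma galerkin_rate_comb v :
  galerkin_rate M alpha QMhalf (comb v) = diag_legendre a v.
Proof.
rewrite /galerkin_rate /diag_legendre.
have [/forallP h|] := boolP [forall i, (a i == 0) ==> (v 0 i == 0)]; last first.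
  move=> nh; rewrite ifF//; apply/negbTE; apply: contra nh; rewrite inE => -[z _ zv].
  apply/forallP => i; apply/implyP; rewrite a_eq0 => /eqP e0.
  have := congr1 (fun x => CL2_dot x (real_basis i)) zv.
  by rewrite QMhalfE !dot_comb mxE e0 sqrtr0 mul0r => <-.
have h' i : eta' i == 0 -> v 0 i == 0 by rewrite -a_eq0; exact/implyP/h.
have Qpre := QMhalf_pre h'.
rewrite ifT; last by rewrite inE; exists (comb (pre v)).
have min_pre z : H_ M z -> QMhalf z = comb v -> `|comb (pre v)| <= `|z|.
  move=> /H_comb_coord -> Qz.
  rewrite -(@ler_pXn2r _ 2)// ?nnegrE// !comb_sqnorm; apply: ler_sum => i _.
  have := congr1 (fun x => CL2_dot x (real_basis i)) Qz.
  rewrite QMhalfE !dot_comb mxE dot_comb [pre v 0 i]mxE => <-.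
  have [e0|e0] := eqVneq (eta' i) 0.
    by rewrite e0 sqrtr0 mul0r mulr0 expr0n sqr_ge0.
  by rewrite mulKf ?lexx// gt_eqF// sqrtr_gt0 lt0r e0 eta'_ge0.
(* Only the norm of the chosen minimizer is compared: minimality on both sides forces equality, and
   uniqueness is not involved. *)
have -> : `|pseudo_inverse M QMhalf (comb v)| = `|comb (pre v)|.
  rewrite /pseudo_inverse; case: xgetP => [z _ [Hz Qz zmin]|/(_ (comb (pre v)))].
    apply/eqP; rewrite eq_le min_pre// zmin//; exact: H_comb.
  by case; split=> //; exact: H_comb.
congr EFin; rewrite comb_sqnorm mulr_sumr mulr_suml; apply: eq_bigr => i _.
rewrite mxE exprMn exprVn sqr_sqrtr// /a.
have [e0|e0] := eqVneq (eta' i) 0; first by rewrite e0 (eqP (h' i _)) ?e0// expr0n/= !mulr0 mul0r.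
by field; rewrite e0 gt_eqF.
Qed.

Lemma galerkin_rate_lty x : (galerkin_rate M alpha QMhalf x < +oo)%E ->
  exists v : 'rV[R]_(M + M), x = comb v.
Proof.
rewrite /galerkin_rate; case: ifPn => [|_]; last by rewrite ltxx.
by rewrite inE => -[z _ <-] _; rewrite QMhalfE; eexists.
Qed.

End galerkin_rate_function.

(** * Coordinate equations of the Galerkin solution *)

Section galerkin_path.
Context {R : realType} {M : nat}.
Local Notation mu := (@lebesgue_measure R).
Implicit Types (k : 'I_M) (f : H0 R).

Lemma dot_cscale_lshift (z : R[i]) f k :
  CL2_dot (CL2_cscale z f) (real_basis (lshift M k)) =
  complex.Re z * CL2_dot f (real_basis (lshift M k)) -
  complex.Im z * CL2_dot f (real_basis (rshift M k)).
Proof.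
rewrite real_basis_lshift real_basis_rshift !CL2_dotE /= !L2_dot0r !addr0 add0r.
by rewrite -scaleNr L2_dotDl !L2_dotZl mulNr.
Qed.

Lemma dot_cscale_rshift (z : R[i]) f k :
  CL2_dot (CL2_cscale z f) (real_basis (rshift M k)) =
  complex.Im z * CL2_dot f (real_basis (lshift M k)) +
  complex.Re z * CL2_dot f (real_basis (rshift M k)).
Proof.
rewrite real_basis_lshift real_basis_rshift !CL2_dotE /= !L2_dot0r !addr0 !add0r.
by rewrite L2_dotDl !L2_dotZl.
Qed.

Variables (alpha : R) (Delta : H0 R -> H0 R) (u0 : H0 R).
Variables (U : R -> H0 R) (Wp : R -> U0 R).
Hypothesis hDelta : is_dirichlet_laplacian Delta.
Hypothesis cU : {within `[0, +oo[, continuous U}.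
Hypothesis UE : forall t : R, 0 <= t -> exists2 v,
  is_integral (fun s => CL2_cscale 'i%C (Delta (P_ M (U s)))) t v &
  U t = P_ M u0 + v + CL2_cscale ('i * alpha%:C)%C (P_ M ((Wp t, 0) : H0 R)).

Definition path_coord (i : 'I_(M + M)) (t : R) : R := CL2_dot (U t) (real_basis i).

Lemma continuous_path_coord i : {within `[0, +oo[, continuous (path_coord i)}.
Proof.
move=> t; apply: (@continuous_comp _ _ _ (U : subspace `[0, +oo[ -> H0 R)
  (fun f => CL2_dot f (real_basis i))); first exact: cU.
exact: continuous_CL2_dot.
Qed.

Let integrable_path_coord i (t : R) : mu.-integrable `[0, t] (EFin \o path_coord i).
Proof.
apply: continuous_compact_integrable; first exact: segment_compact.
apply: continuous_subspaceW (continuous_path_coord (i := i)).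
by move=> s /=; rewrite !in_itv/= => /andP[->].
Qed.

Let dotD3 (a b c : H0 R) (i : 'I_(M + M)) : CL2_dot (a + b + c) (real_basis i) =
  CL2_dot a (real_basis i) + CL2_dot b (real_basis i) + CL2_dot c (real_basis i).
Proof. by rewrite !CL2_dotDl. Qed.

Let dot_P f (i : 'I_(M + M)) : CL2_dot (P_ M f) (real_basis i) = CL2_dot f (real_basis i).
Proof. by rewrite P_comb_coord dot_comb mxE. Qed.

Let dot_Delta (s : R) (i : 'I_(M + M)) : CL2_dot (Delta (P_ M (U s))) (real_basis i) =
  - ((mode i)%:R ^+ 2) * path_coord i s.
Proof. by rewrite P_comb_coord laplacian_comb// dot_comb !mxE. Qed.

Let i_alphaE : ('i * alpha%:C)%C = Complex 0 alpha.
Proof. by rewrite -complexiE; apply/eqP; rewrite eq_complex/=; apply/andP; split; apply/eqP; ring. Qed.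

(** The noise is i alpha times a real process, so the real coordinates are noise-free;
    multiplication by i swaps the two halves and turns the eigenvalue - k^2 into a rotation. *)
Lemma path_coord_lshift k t : 0 <= t ->
  path_coord (lshift M k) t = CL2_dot u0 (real_basis (lshift M k)) +
    k.+1%:R ^+ 2 * \int[mu]_(s in `[0, t]) path_coord (rshift M k) s.
Proof.
move=> /UE[v hv Ut]; rewrite {1}/path_coord Ut dotD3 !dot_P dot_cscale_lshift.
have [_ ->] := hv (real_basis (lshift M k)).
rewrite -RintegralZl//.
have -> : CL2_dot (P_ M ((Wp t, 0) : H0 R)) (real_basis (rshift M k)) = 0.
  by rewrite dot_P real_basis_rshift CL2_dotE /= L2_dot0r L2_dot0l addr0.
have -> : complex.Re ('i * alpha%:C)%C = 0 by rewrite i_alphaE.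
rewrite mul0r mulr0 subr0 addr0; congr (_ + _); apply: eq_Rintegral => s _.
by rewrite dot_cscale_lshift !dot_Delta !mode_lshift !mode_rshift /=; ring.
Qed.

Lemma path_coord_rshift k t : 0 <= t ->
  path_coord (rshift M k) t = CL2_dot u0 (real_basis (rshift M k)) -
    k.+1%:R ^+ 2 * \int[mu]_(s in `[0, t]) path_coord (lshift M k) s +
    alpha * L2_dot (Wp t) (e_ k.+1).
Proof.
move=> /UE[v hv Ut]; rewrite {1}/path_coord Ut dotD3 !dot_P dot_cscale_rshift.
have [_ ->] := hv (real_basis (rshift M k)).
rewrite -mulNr -RintegralZl//.
have -> : CL2_dot (P_ M ((Wp t, 0) : H0 R)) (real_basis (rshift M k)) = 0.
  by rewrite dot_P real_basis_rshift CL2_dotE /= L2_dot0r L2_dot0l addr0.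
have -> : CL2_dot (P_ M ((Wp t, 0) : H0 R)) (real_basis (lshift M k)) =
    L2_dot (Wp t) (e_ k.+1).
  by rewrite dot_P real_basis_lshift CL2_dotE /= L2_dot0r addr0.
have -> : complex.Im ('i * alpha%:C)%C = alpha by rewrite i_alphaE.
rewrite mulr0 addr0; congr (_ + _ + _); apply: eq_Rintegral => s _.
by rewrite dot_cscale_rshift !dot_Delta !mode_lshift !mode_rshift /=; ring.
Qed.

End galerkin_path.

Section brownian_sums.
Context {d : measure_display} {Omega : measurableType d} {R : realType}.
Variables (P : probability Omega R) (F : R -> set (set Omega)).
Variable beta : nat -> R -> Omega -> R.
Hypotheses (filtF : filtration F)
  (bm : forall k, (0 < k)%N -> brownian_motion P F (beta k))
  (ind : independent_processes P beta).

Lemma process_sigma_measurable k : (0 < k)%N -> process_sigma (beta k) `<=` measurable.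
Proof.
move=> k0; apply: smallest_sub; first exact: sigma_algebra_measurable.
move=> _ [t [A [t0 mA ->]]].
by rewrite -[X in measurable X]setTI; apply: (measurable_brownian filtF (bm k0)).
Qed.

Lemma measurable_increments_sum k (c t : nat -> R) n : (0 < k)%N ->
  (forall j, 0 <= t j) -> measurable_fun [set: Omega] (increments_sum (beta k) c t n).
Proof.
move=> k0 t0; apply: sub_measurableW (increments_sum_process_sigma c n t0).
exact: process_sigma_measurable.
Qed.

Lemma integral_expR_sum_increments M (c : nat -> nat -> R) (t : nat -> R) n :
  0 <= t 0%N -> (forall j, t j < t j.+1) ->
  (\int[P]_w (expR (\sum_(i < M) increments_sum (beta i.+1) (c i.+1) t n w))%:E =
   (expR (\sum_(i < M) (\sum_(j < n) c i.+1 j ^+ 2 * (t j.+1 - t j)) / 2))%:E)%E.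
Proof.
move=> t0 ti; have tp j : 0 <= t j.
  by elim: j => // j /le_trans; apply; exact: ltW.
pose m k := expR ((\sum_(j < n) c k j ^+ 2 * (t j.+1 - t j)) / 2).
rewrite (@integral_prod_expR_indep _ _ _ P beta ind M
  (fun k => increments_sum (beta k) (c k) t n) m).
- by rewrite expR_sum.
- by move=> k k0; exact: measurable_increments_sum.
- by move=> k _; exact: increments_sum_process_sigma.
- by move=> k; exact: expR_ge0.
- by move=> k k0; exact: integral_expR_increments_sum (bm k0) _ _ _ t0 ti.
- exact: process_sigma_measurable.
Qed.

Lemma increments_sumZ B (r : R) (c t : nat -> R) n (w : Omega) :
  increments_sum B (fun j => r * c j) t n w = r * increments_sum B c t n w.
Proof. by rewrite mulr_sumr; apply: eq_bigr => j _; rewrite mulrA. Qed.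

End brownian_sums.

(** * Exponential moments of the Galerkin solution *)

Section galerkin_mgf.
Context {d : measure_display} {Omega : measurableType d} {R : realType}.
Variables (P : probability Omega R) (F : R -> set (set Omega)).
Variables (alpha : R) (Delta : H0 R -> H0 R) (eta : nat -> R).
Variables (beta : nat -> R -> Omega -> R) (W : R -> Omega -> U0 R).
Variables (u0 : H0 R) (M : nat) (uM : R -> Omega -> H0 R).
Hypotheses (filtF : filtration F) (hDelta : is_dirichlet_laplacian Delta).
Hypothesis eta_ge0 : forall k, (0 < k)%N -> 0 <= eta k.
Hypothesis bm : forall k, (0 < k)%N -> brownian_motion P F (beta k).
Hypothesis ind : independent_processes P beta.
Hypothesis hW : is_wiener_series P eta beta W.
Hypothesis hu : galerkin_solution P F alpha Delta W u0 M uM.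

Definition galerkin_coord (T : R) (w : Omega) : 'rV[R]_(M + M) := coord (uM T w).

Lemma measurable_galerkin_coord (T : R) : 0 < T -> forall i,
  measurable_fun [set: Omega] (fun w => galerkin_coord T w 0 i).
Proof.
move=> T0 i; have [adapted _ _ _] := hu.
apply: (measurability (@RGenOInfty.G R)); first exact: RGenOInfty.measurableE.
move=> _ [_ [x ->] <-]; rewrite setTI.
have [/(_ T (ltW T0))[_ FM] _] := filtF; apply: FM.
have -> : (fun w => galerkin_coord T w 0 i) @^-1` `]x, +oo[ =
    uM T @^-1` ((fun f => CL2_dot f (real_basis i)) @^-1` [set y | x < y]).
  by apply/seteqP; split => w; rewrite /= mxE in_itv/= andbT.
apply: adapted; first exact: ltW.
by apply: open_comp => [f _|]; [exact: continuous_CL2_dot|exact: open_gt].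
Qed.

(** Paired with a fixed basis vector, the partial sums of the series are eventually constant, so
    continuity of the pairing identifies the limit. *)
Lemma dot_wiener : \forall w \ae P, forall (k : 'I_M) (t : R), 0 <= t ->
  L2_dot (W t w) (e_ k.+1) = Num.sqrt (eta k.+1) * beta k.+1 t w.
Proof.
apply: filterS hW => w Ww k t t0.
have cv := Ww t t0.
have := @cvg_comp _ _ _ _ (fun f : U0 R => L2_dot f (e_ k.+1)) _ _ _ cv
  (@continuous_L2_dot _ _ _ _ (e_ k.+1) (W t w)).
move=> /cvg_lim <- //; apply: lim_near_cst => //; near=> n.
rewrite /= L2_dot_suml big_add1 big_mkord /=.
have kn : (k < n)%N by near: n; exact: nbhs_infty_gt.
rewrite (bigD1 (Ordinal kn))//= big1 ?addr0 => [|j jk].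
  by rewrite L2_dotZl e_orthonormal// eqxx mulr1.
rewrite L2_dotZl e_orthonormal// eqSS (_ : (j == k :> nat) = false) ?mulr0//.
by apply/negbTE; move: jk; rewrite -val_eqE.
Unshelve. all: by end_near. Qed.

(** Bridges the weights, indexed by ['I_M], and the processes, indexed by the naturals from 1; the
    default 0 is never reached in the sums. *)
Let ext (f : 'I_M -> R) (k : nat) : R := oapp f 0 (insub k.-1).

Let extE f (i : 'I_M) : ext f i.+1 = f i.
Proof. by rewrite /ext /= valK. Qed.

Let a (i : 'I_(M + M)) := alpha ^+ 2 * eta (mode i) / 2.

Section fixed_parameter.
Variable th : 'rV[R]_(M + M).
Let p (k : 'I_M) := th 0 (lshift M k).
Let q (k : 'I_M) := th 0 (rshift M k).
Let l (k : 'I_M) : R := k.+1%:R ^+ 2.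
Let x0 (k : 'I_M) := CL2_dot u0 (real_basis (lshift M k)).
Let y0 (k : 'I_M) := CL2_dot u0 (real_basis (rshift M k)).
Let phi (T : R) (k : 'I_M) := rot_cos (l k) (p k) (q k) T.
Let psi (T : R) (k : 'I_M) := rot_sin (l k) (p k) (q k) T.

Let mean (T : R) : R := \sum_(k < M) (phi T k 0 * x0 k + psi T k 0 * y0 k).
Let variance (T : R) : R := \sum_(k < M) alpha ^+ 2 * eta k.+1 * (((p k) ^+ 2 + (q k) ^+ 2) * T / 2 +
  (phi T k T * psi T k T - phi T k 0 * psi T k 0) / (2 * l k)).

Let coef (T : R) (n k j : nat) : R := alpha * Num.sqrt (eta k) * ext (fun i : 'I_M => psi T i (grid T n j)) k.

Let S (T : R) (n : nat) (w : Omega) : R := \sum_(i < M) increments_sum (beta i.+1) (coef T n i.+1) (grid T n) n.+1 w.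

Let sum_sqr (T : R) (n : nat) : R := \sum_(i < M)
  (\sum_(j < n.+1) coef T n i.+1 j ^+ 2 * (grid T n j.+1 - grid T n j)) / 2.

(** The factor r is 1 for the exponential moment itself and 2 for the second moment of the
    exponential. *)
Let integral_expR_S (T : R) (n : nat) (r : R) : 0 < T ->
  (\int[P]_w (expR (r * S T n w))%:E = (expR (r ^+ 2 * sum_sqr T n))%:E)%E.
Proof.
move=> T0.
have := @integral_expR_sum_increments _ _ _ P F beta filtF bm ind M
  (fun k j => r * coef T n k j) (grid T n) n.+1.
rewrite grid0 => /(_ (lexx _) (fun j => grid_lt n j T0)) h.
transitivity (\int[P]_w (expR (\sum_(i < M) increments_sum (beta i.+1)
    (fun j => r * coef T n i.+1 j) (grid T n) n.+1 w))%:E)%E.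
  apply: eq_integral => w _; rewrite /S mulr_sumr; congr (expR _)%:E.
  by apply: eq_bigr => i _; rewrite increments_sumZ.
rewrite h; congr (expR _)%:E; rewrite mulr_sumr; apply: eq_bigr => i _.
rewrite mulrA; congr (_ / _); rewrite mulr_sumr; apply: eq_bigr => j _.
by rewrite exprMn mulrA.
Qed.

Let cvg_sum_sqr (T : R) : 0 < T -> sum_sqr T n @[n --> \oo] --> variance T / 2.
Proof.
move=> T0; rewrite /variance mulr_suml.
apply: (cvg_big (@add_continuous _)) => i _.
have l0 : l i != 0 by rewrite expf_neq0// pnatr_eq0.
have h := @cvg_rot_sin_sqr _ (l i) (p i) (q i) T T0 l0.
apply: cvgM; last exact: cvg_cst.
rewrite [X in X @ _ --> _](_ : _ = (fun n => alpha ^+ 2 * eta i.+1 *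
  \sum_(j < n.+1) psi T i (grid T n j) ^+ 2 * (grid T n j.+1 - grid T n j))).
  by apply: cvgM; [exact: cvg_cst|exact: h].
apply/funext => n; rewrite mulr_sumr; apply: eq_bigr => j _.
by rewrite /coef extE !exprMn sqr_sqrtr ?eta_ge0// mulrA.
Qed.

Let cvg_S (T : R) : 0 < T -> \forall w \ae P,
  S T n w @[n --> \oo] --> rv_dot th (galerkin_coord T w) - mean T.
Proof.
move=> T0; have [_ _ contu solu] := hu.
have b0 : \forall w \ae P, forall i : 'I_M, beta i.+1 0 w = 0.
  by apply: filter_forall => i; have [] := bm (ltn0Sn i).
have bc : \forall w \ae P, forall i : 'I_M,
    {within `[0, +oo[, continuous (beta i.+1 ^~ w)}.
  by apply: filter_forall => i; have [] := bm (ltn0Sn i).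
apply: filterS3 (filterI b0 bc) (filterI contu solu) dot_wiener.
move=> w [bw0 bwc] [cu su] dw.
have -> : rv_dot th (galerkin_coord T w) - mean T =
    \sum_(i < M) (p i * path_coord (M := M) (uM ^~ w) (lshift M i) T +
      q i * path_coord (M := M) (uM ^~ w) (rshift M i) T -
      (phi T i 0 * x0 i + psi T i 0 * y0 i)).
  rewrite sumrB /mean /rv_dot big_split_ord/= -big_split/=; congr (_ - _).
  by apply: eq_bigr => i _; rewrite !mxE.
apply: (cvg_big (@add_continuous _)) => i _.
pose b (t : R) := alpha * (Num.sqrt (eta i.+1) * beta i.+1 t w).
have cb : {within `[0, +oo[, continuous b}.
  move=> t; apply: cvgM; first exact: cvg_cst.
  by apply: cvgM; [exact: cvg_cst|exact: bwc].
have xE t : 0 <= t -> path_coord (M := M) (uM ^~ w) (lshift M i) t = x0 i +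
    l i * \int[lebesgue_measure]_(s in `[0, t]) path_coord (uM ^~ w) (rshift M i) s.
  exact: (path_coord_lshift hDelta cu su).
have yE t : 0 <= t -> path_coord (M := M) (uM ^~ w) (rshift M i) t = y0 i -
    l i * \int[lebesgue_measure]_(s in `[0, t]) path_coord (uM ^~ w) (lshift M i) s + b t.
  by move=> t0; rewrite (path_coord_rshift hDelta cu su)// dw.
have b00 : b 0 = 0 by rewrite /b bw0 !mulr0.
have := oscillator_stochastic_sum (p := p i) (q := q i) T0 (continuous_path_coord cu (i := lshift M i))
  (continuous_path_coord cu (i := rshift M i)) cb xE yE b00.
rewrite [X in X @ _ --> _ -> _](_ : _ = (fun n =>
  increments_sum (beta i.+1) (coef T n i.+1) (grid T n) n.+1 w))//.
apply/funext => n; apply: eq_bigr => j _; rewrite /coef extE /b /psi; ring.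
Qed.

Let integral_expR_galerkin (T : R) : 0 < T ->
  (\int[P]_w (expR (rv_dot th (galerkin_coord T w)))%:E =
   (expR (mean T + variance T / 2))%:E)%E.
Proof.
move=> T0; pose f w := expR (rv_dot th (galerkin_coord T w) - mean T).
have mdot : measurable_fun [set: Omega] (fun w => rv_dot th (galerkin_coord T w)).
  exact: (measurable_rv_dot measurable_galerkin_coord).
have mf : measurable_fun [set: Omega] f.
  by apply: measurableT_comp => //; apply: measurable_funB.
have mS n : measurable_fun [set: Omega] (S T n).
  apply: measurable_sum => i; apply: (measurable_increments_sum filtF bm) => // j.
  by rewrite /grid divr_ge0// mulr_ge0// ltW.
have fE : (\int[P]_w (f w)%:E = (expR (variance T / 2))%:E)%E.
  (* The second moment is exp (4 [sum_sqr T n]), and [sum_sqr T n] is eventually below its limit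
     plus 1. *)
  apply: (@cvg_integral_bounded_sqr _ _ _ P (fun n w => expR (S T n w)) f _
    (expR (4 * (variance T / 2 + 1)))) => //.
  - by move=> n; apply: measurableT_comp.
  - by move=> w; exact: expR_ge0.
  - apply: filterS (cvg_S T0) => w Sw.
    by apply: continuous_cvg Sw; exact: continuous_expR.
  - rewrite (_ : (fun n => _) = (fun n => (expR (sum_sqr T n))%:E)); last first.
      apply/funext => n; have := integral_expR_S n 1 T0; rewrite expr1n mul1r => <-.
      by apply: eq_integral => w _; rewrite mul1r.
    apply: cvg_EFin; first exact: nearW.
    by apply: continuous_cvg (cvg_sum_sqr T0); exact: continuous_expR.
  near=> n.
  have -> : (\int[P]_w (expR (S T n w) ^+ 2)%:E = (expR (2 ^+ 2 * sum_sqr T n))%:E)%E.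
    rewrite -integral_expR_S//; apply: eq_integral => w _.
    by rewrite -expRM_natl.
  rewrite lee_fin ler_expR expr2 -natrM ler_pM2l//.
  near: n; apply: (cvgr_le _ (cvg_sum_sqr T0)); by rewrite ltrDl.
have := @integral_expR_rv_dotD _ _ _ P _ (galerkin_coord) measurable_galerkin_coord th T (- mean T) T0.
rewrite fE => E.
have : ((expR (mean T))%:E * (expR (variance T / 2))%:E =
  (expR (mean T))%:E * ((expR (- mean T))%:E *
   \int[P]_w (expR (rv_dot th (galerkin_coord T w)))%:E))%E by rewrite -E.
by rewrite muleA -!EFinM -!expRD subrr expR0 mul1e => <-.
Unshelve. all: by end_near. Qed.

Lemma galerkin_mgf : exists C : R, forall T : R, 0 < T ->
  ((expR (T * diag_form a th - C))%:E <=
     \int[P]_w (expR (rv_dot th (galerkin_coord T w)))%:E <=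
   (expR (T * diag_form a th + C))%:E)%E.
Proof.
pose K (k : 'I_M) := `|p k| + `|q k|.
(* [K] bounds both rotating weights at all times. The first summand controls the initial value, the
   second the boundary terms of the variance, where 1 / (2 l) <= 1 since l is the square of a
   positive integer; so [C] is free of T. *)
pose C (k : 'I_M) := K k * (`|x0 k| + `|y0 k|) + `|alpha ^+ 2 * eta k.+1| * (K k ^+ 2 + K k ^+ 2) / 2.
exists (\sum_(k < M) C k) => T T0; rewrite integral_expR_galerkin// !lee_fin !ler_expR.
have formE : T * diag_form a th =
    \sum_(k < M) alpha ^+ 2 * eta k.+1 * ((p k ^+ 2 + q k ^+ 2) * T / 2) / 2.
  rewrite /diag_form big_split_ord/= -big_split/= mulrA mulr_sumr mulr_suml.
  apply: eq_bigr => k _; rewrite /a mode_lshift mode_rshift -/(p k) -/(q k); by field.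
pose D (T : R) (k : 'I_M) := phi T k T * psi T k T - phi T k 0 * psi T k 0.
have diff : mean T + variance T / 2 - T * diag_form a th =
    \sum_(k < M) (phi T k 0 * x0 k + psi T k 0 * y0 k +
      alpha ^+ 2 * eta k.+1 * (D T k / (2 * l k)) / 2).
  rewrite formE /mean /variance mulr_suml -big_split -sumrB/=.
  by apply: eq_bigr => k _; rewrite -/(D T k); ring.
suff : `|mean T + variance T / 2 - T * diag_form a th| <= \sum_(k < M) C k.
  by rewrite ler_norml => /andP[h1 h2]; apply/andP; split; lra.
rewrite diff (le_trans (ler_norm_sum _ _ _))//; apply: ler_sum => k _.
have hphi s : `|phi T k s| <= K k by exact: rot_cos_bound.
have hpsi s : `|psi T k s| <= K k by exact: rot_sin_bound.
rewrite (le_trans (ler_normD _ _))// lerD//.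
  apply: (le_trans (ler_normD _ _)); rewrite [leRHS]mulrDr !normrM.
  by apply: lerD; apply: ler_wpM2r.
rewrite normrM [X in _ * X <= _]ger0_norm ?invr_ge0// ler_pM2r ?invr_gt0//.
rewrite normrM ler_wpM2l// normrM normfV -[leRHS]mulr1; apply: ler_pM => //.
- rewrite (le_trans (ler_normB _ _))// lerD// normrM expr2 ler_pM//.
- rewrite invf_le1 ?normr_gt0 ?mulf_neq0 ?expf_neq0 ?pnatr_eq0//.
  rewrite ger0_norm ?mulr_ge0 ?sqr_ge0// /l.
  by rewrite -natrX -natrM ler1n muln_gt0 expn_gt0.
Qed.

End fixed_parameter.

End galerkin_mgf.

Theorem theorem4p1 (R : realType) (d : measure_display)
    (Omega : measurableType d) (P : probability Omega R)
    (F : R -> set (set Omega))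
    (alpha : R) (Delta : H0 R -> H0 R)
    (eta : nat -> R) (Q Qhalf : {linear U0 R -> U0 R})
    (beta : nat -> R -> Omega -> R) (W : R -> Omega -> U0 R)
    (u0 : H0 R) (M : nat) (QMhalf : {linear H0 R -> H0 R})
    (uM : R -> Omega -> H0 R) :
  filtration F -> usual_conditions P F ->
  0 < alpha ->
  is_dirichlet_laplacian Delta ->
  nonneg_symmetric L2_dot Q ->
  (forall k, (0 < k)%N -> 0 <= eta k) ->
  (forall k l, (0 < k <= l)%N -> eta l <= eta k) ->
  (forall k, (0 < k)%N -> Q (e_ k) = eta k *: e_ k) ->
  is_sqrt_operator L2_dot Q Qhalf ->
  hilbert_schmidt_U0_U1 Qhalf ->
  (forall k, (0 < k)%N -> brownian_motion P F (beta k)) ->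
  independent_processes P beta ->
  is_wiener_series P eta beta W ->
  H10 u0 ->
  (0 < M)%N ->
  is_sqrt_operator CL2_dot (complexify Q \o P_ M) QMhalf ->
  galerkin_solution P F alpha Delta W u0 M uM ->
  satisfies_ldp P (fun T w => T^-1 *: uM T w) (galerkin_rate M alpha QMhalf) /\
  good_rate_function (galerkin_rate M alpha QMhalf).
Proof.
move=> filtF _ alpha_gt0 hDelta _ eta_ge0 _ Qe _ _ bm ind hW _ _ sqrtQ hu.
have [adapted inH _ _] := hu.
(* [comb] embeds the coordinate space isometrically onto [H_ M], which carries the principle from
   coordinates to the full space. *)
apply: (@contracted_gaussian_ldp _ _ _ P _
  (fun i => alpha ^+ 2 * eta (mode i) / 2) (galerkin_coord M uM) _ _ _ _ comb).
- by move=> i; rewrite divr_ge0// mulr_ge0 ?sqr_ge0// eta_ge0// mode_gt0.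
- exact: (measurable_galerkin_coord filtF hu).
- exact: (galerkin_mgf filtF hDelta eta_ge0 bm ind hW hu).
- exact: norm_hausdorff.
- exact: continuous_comb.
- exact: (galerkin_rate_comb alpha_gt0 eta_ge0 Qe sqrtQ).
- exact: (galerkin_rate_lty eta_ge0 Qe sqrtQ).
- by move=> T T0 w; rewrite combZ -H_comb_coord//; apply: inH; exact: ltW.
move=> T T0 G oG; have [/(_ T (ltW T0))[_ FM] _] := filtF; apply: FM.
rewrite (_ : _ @^-1` G = uM T @^-1` ((fun f : H0 R => T^-1 *: f) @^-1` G))//.
apply: adapted; first exact: ltW.
by apply: open_comp => // f _; exact: scaler_continuous.
Qed.
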